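(* Let $\ell\ge1$ be an integer and let $K_m$ be the complete graph on $m$ vertices. For all $g:K_m\to\mathbb{R}$, $\mathrm{NTC}(g)\ge\pi\ell^2$ if $m=2\ell$ is even, and $\mathrm{NTC}(g)\ge\pi\ell(\ell+1)$ if $m=2\ell+1$ is odd. Equality holds for any mapping of $K_m$ into $\mathbb{R}$ with vertices in general position (distinct values at distinct vertices) and monotone on each edge; therefore $$\mathrm{NTC}(\{K_{2\ell}\})=\pi\ell^2\quad\text{and}\quad\mathrm{NTC}(\{K_{2\ell+1}\})=\pi\ell(\ell+1).$$
   Context: Mappings $f$ of a finite graph $\Gamma$ into $\mathbb{R}^n$ are piecewise $C^2$: after adding finitely many degree-2 vertices, each edge is mapped as a regular $C^2$ arc up to its endpoints; $f$ need not be an embedding. Monotone means strictly monotone. Net total curvature: at a vertex $q$ of degree $d$ with unit tangent vectors $T_1,\dots,T_d\in S^{n-1}$ pointing into the edges ending at $q$, let $\chi_i:S^{n-1}\to\{\pm1\}$ be $-1$ where $\langle e,T_i\rangle>0$ and $+1$ where $\langle e,T_i\rangle<0$ (a.e.). Set $\mathrm{ntc}(q)=\pi$ times the average over $e\in S^{n-1}$ of $\big[\sum_{i=1}^d\chi_i(e)\big]^+$ (for $n=1$, the average over $S^0=\{\pm1\}$), and $\mathrm{NTC}(f)=\sum_q\mathrm{ntc}(q)+\int|\vec k|\,ds$, the sum over all vertices (including those of degree 2) and the integral of the curvature over the open $C^2$ edges. $\mathrm{NTC}(\{\Gamma\})$ is the infimum of $\mathrm{NTC}(f)$ over all mappings $f:\Gamma\to\mathbb{R}^n$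 (all $n$). *)

(* Defs.v *)
From HB Require Import structures.
From mathcomp Require Import all_boot all_order all_algebra.
From mathcomp Require Import all_classical all_reals all_analysis.

Set Implicit Arguments.
Unset Strict Implicit.
Unset Printing Implicit Defensive.

Import Order.TTheory GRing.Theory Num.Theory.
Import numFieldNormedType.Exports.

Local Open Scope classical_set_scope.
Local Open Scope ring_scope.

(* Points of R^n are row vectors ['rV[R]_n].  The library norm [`|v|] on row
   vectors is the sup norm (used only through the topology it induces), so the
   Euclidean norm is introduced as [enorm]. *)

Section Euclidean.
Context {R : realType}.

Definition dot n (u v : 'rV[R]_n) : R := \sum_(i < n) u ord0 i * v ord0 i.

Definition enorm n (v : 'rV[R]_n) : R := Num.sqrt (dot v v).

Definition unitv n (v : 'rV[R]_n) : 'rV[R]_n := (enorm v)^-1 *: v.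

End Euclidean.

Section SphereAverage.
Context {R : realType}.
Local Notation T := (measurableTypeR R).

Section LebesgueCons.
Context (n : nat) (nu : {measure set (n.-tuple T) -> \bar R}).

Definition cons_tuple (p : n.-tuple T * T) : n.+1.-tuple T :=
  [the n.+1.-tuple T of p.2 :: p.1].

Let measurable_cons_tuple : measurable_fun [set: n.-tuple T * T] cons_tuple.
Proof. exact: measurable_cons. Qed.

(* product of one-dimensional Lebesgue measure with [nu] *)
Definition lebesgue_cons : set (n.+1.-tuple T) -> \bar R :=
  pushforward (nu \x @lebesgue_measure R)%E cons_tuple.

Let lebesgue_cons0 : lebesgue_cons set0 = 0%E.
Proof. exact: measure0. Qed.

Let lebesgue_cons_ge0 A : (0 <= lebesgue_cons A)%E.
Proof. exact: measure_ge0. Qed.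

Let lebesgue_cons_sigma_additive : semi_sigma_additive lebesgue_cons.
Proof. exact: measure_semi_sigma_additive. Qed.

HB.instance Definition _ := isMeasure.Build _ _ _ lebesgue_cons
  lebesgue_cons0 lebesgue_cons_ge0 lebesgue_cons_sigma_additive.

End LebesgueCons.

(* Lebesgue measure on R^n *)
Fixpoint lebesgue_tuple n : {measure set (n.-tuple T) -> \bar R} :=
  match n with
  | 0 => \d_([tuple] : 0.-tuple T)
  | n'.+1 => lebesgue_cons (lebesgue_tuple n')
  end.

Definition row_of_tuple n (x : n.-tuple T) : 'rV[R]_n :=
  \row_(i < n) (tnth x i : R).

Definition unit_ball n : set (n.-tuple T) :=
  [set x | enorm (row_of_tuple x) <= 1].

(* The average of F over S^{n-1} with respect to the uniform probability
   measure sigma, which is normalized surface measure in its cone form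
     sigma(A) = Leb{x in B | x/|x| \in A} / Leb(B),  B the unit ball of R^n;
   for n = 1 it gives mass 1/2 to each point of S^0 = {1, -1}. *)
Definition sphere_average n (F : 'rV[R]_n -> R) : \bar R :=
  (((fine (lebesgue_tuple n (@unit_ball n)))^-1)%:E *
   \int[lebesgue_tuple n]_(x in @unit_ball n)
     (F (unitv (row_of_tuple x)))%:E)%E.

End SphereAverage.

Section Curves.
Context {R : realType} {n : nat}.
Implicit Types c : R -> 'rV[R]_n.

Definition C2 c : Prop :=
  [/\ forall t, derivable c t 1,
      forall t, derivable c^`()%classic t 1
    & continuous c^`(2)%classic].

(* C^2 and regular on the closed interval, endpoints included: c restricted to
   [a, b] extends to a C^2 curve whose velocity does not vanish on [a, b]. *)
Definition regular_C2_arc (a b : R) c : Prop :=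
  exists gamma : R -> 'rV[R]_n,
    [/\ C2 gamma,
        {in `[a, b], c =1 gamma}
      & {in `[a, b], forall t, gamma^`()%classic t != 0}].

(* Unit tangent vectors at c(t) of the two sub-arcs of c starting and ending
   at t; both point away from c(t), into the sub-arc. *)
Definition tangent_after c (t : R) : 'rV[R]_n :=
  unitv (lim (h^-1 *: (c (t + h) - c t) @[h --> 0^'+])).

Definition tangent_before c (t : R) : 'rV[R]_n :=
  unitv (lim (h^-1 *: (c (t - h) - c t) @[h --> 0^'+])).

Definition speed c (t : R) : R := enorm (c^`()%classic t).

(* the curvature vector dT/ds, with T the unit tangent and s the arc length *)
Definition curvature_vector c (t : R) : 'rV[R]_n :=
  (speed c t)^-1 *: (fun u => unitv (c^`()%classic u))^`()%classic t.

Definition total_curvature c (a b : R) : \bar R :=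
  (\int[lebesgue_measure]_(t in `]a, b[)
     (enorm (curvature_vector c t) * speed c t)%:E)%E.

End Curves.

(* Finite graphs as one-dimensional cell complexes; loops and multiple edges
   are allowed.  The orientation of an edge only serves to parametrize it. *)
Record multigraph := Multigraph {
  vert : finType;
  edge : finType;
  src : edge -> vert;
  tgt : edge -> vert }.

Definition complete_graph (m : nat) : multigraph :=
  @Multigraph 'I_m {p : 'I_m * 'I_m | (p.1 < p.2)%N}
    (fun e => (val e).1) (fun e => (val e).2).

(* the closed intervals into which the points of s cut [0, 1] *)
Definition pieces (R : realType) (s : seq R) : seq (R * R) :=
  zip (0 :: s) (rcons s 1).

(* A piecewise C^2 mapping of G into R^n.  Every edge e is identified with
   [0, 1], running from src e to tgt e, and is mapped by [curve e] (only the
   values on [0, 1] matter); [brk e] lists in increasing order the parameters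
   in (0, 1) of the degree-2 vertices added on e.  Continuity follows from the
   conditions on the pieces. *)
Record pwC2_map (R : realType) (G : multigraph) (n : nat) := PwC2Map {
  pos : vert G -> 'rV[R]_n;
  curve : edge G -> R -> 'rV[R]_n;
  brk : edge G -> seq R;
  curve_src : forall e, curve e 0 = pos (src e);
  curve_tgt : forall e, curve e 1 = pos (tgt e);
  brk_sorted : forall e, path <%R 0 (rcons (brk e) 1);
  curve_regular : forall e p, p \in pieces (brk e) ->
    regular_C2_arc p.1 p.2 (curve e) }.

Section NetTotalCurvature.
Context {R : realType}.

(* -1 if <e, v> > 0 and +1 if <e, v> < 0 *)
Definition chi n (v e : 'rV[R]_n) : R := - Num.sg (dot e v).

Definition ntc n (Ts : seq 'rV[R]_n) : \bar R :=
  (pi%:E *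
   sphere_average (fun e => Num.max (\sum_(v <- Ts) chi v e) 0)%R)%E.

Variables (G : multigraph) (n : nat) (f : pwC2_map R G n).

(* a loop at q contributes both of its ends *)
Definition tangents_at (q : vert G) : seq 'rV[R]_n :=
  [seq tangent_after (curve f e) 0 | e <- enum (edge G) & src e == q] ++
  [seq tangent_before (curve f e) 1 | e <- enum (edge G) & tgt e == q].

Definition tangents_at_brk (e : edge G) (t : R) : seq 'rV[R]_n :=
  [:: tangent_before (curve f e) t; tangent_after (curve f e) t].

Definition NTC : \bar R :=
  (\sum_(q : vert G) ntc (tangents_at q) +
   \sum_(e : edge G) \sum_(t <- brk f e) ntc (tangents_at_brk e t) +
   \sum_(e : edge G) \sum_(p <- pieces (brk f e))
     total_curvature (curve f e) p.1 p.2)%E.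

End NetTotalCurvature.

(* infimum over the mappings into R^n for all n >= 1 *)
Definition NTC_graph (R : realType) (G : multigraph) : \bar R :=
  ereal_inf [set x | exists n, exists f : pwC2_map R G n.+1, x = NTC f].

Section MapsToLine.
Context {R : realType} {G : multigraph}.
Implicit Type g : pwC2_map R G 1.

Definition vertices_in_general_position g : Prop := injective (pos g).

(* strictly monotone on [0, 1] as a real-valued function *)
Definition monotone_on_edge g (e : edge G) : Prop :=
  let h (t : R) : R := curve g e t ord0 ord0 in
  {in `[0, 1] &, {homo h : s t / s < t}} \/
  {in `[0, 1] &, {homo h : s t /~ s < t}}.

End MapsToLine.

(* Main.v *)
Require Import Defs.
From HB Require Import structures.
From mathcomp Require Import all_boot all_order all_algebra.
From mathcomp Require Import all_classical all_reals all_analysis.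
From mathcomp Require Import measurable_realfun ring lra.

(** Project the map f orthogonally to a line, x being the direction.  For almost
    every x the height <x, f> is nondegenerate at the vertices, and the integrand
    of NTC, seen from x, counts local maxima: a vertex q contributes the positive
    part of (edges leaving q downwards) - (edges leaving q upwards), and a point in
    the interior of an edge contributes 2 if it is a local maximum and 0 otherwise.
    Both halves of the theorem come from one combinatorial bound on this count,
    integrated over x.

    The bound (tournament_lower_bound).  Order the vertices by height, breaking
    ties by index.  If every edge were monotone, the vertex with k vertices below it
    would contribute (2k - (m-1))^+, and these numbers add up to l^2 for m = 2l and
    to l(l+1) for m = 2l+1 (total_score).  An edge that leaves its higher end
    upwards has to come down again, so it carries a local maximum; the 2 which that
    maximum contributes pays for replacing the edge by a monotone one.

    Integrating over x.  For vertices and breakpoints the average over directions is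
    the definition of ntc.  For a C^2 arc one needs a one-sided Crofton inequality:
    the directions x for which the height along the arc somewhere increases and
    later decreases have measure at most 1/(2 pi) times the total curvature
    (turning_le).  Cut the arc finely.  Up to null sets, such an x sees two
    consecutive unit tangents u, v with <x, u> > 0 > <x, v>, so it lies in the lune
    they span; a lune has measure angle/(2 pi) (sph_lune_chord gives the upper bound
    that is needed), the angle is asymptotically the chord |u - v|, and the chords
    add up to at most the integral of |dT|, which is the total curvature.
    Refining the subdivision exhausts the set of such directions.

    The measure of a lune is computed from rotation invariance alone: all lunes of
    angle t have the same measure, and K of them fit disjointly around a great
    circle when K t <= 2 pi.  Invariance of Lebesgue measure under reflections
    (leb_refl) follows from translation invariance by the uniqueness argument for
    Haar measure, with the unit ball as the test set.

    On the line, if the vertex values are distinct and the edges monotone, all the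
    inequalities are equalities: tangents are constant, so there is no curvature
    and breakpoints cancel, and every vertex contributes exactly its score
    (NTC_monotone).  Straight edges between distinct points realize this, which
    gives the infimum over all dimensions. *)

Set Implicit Arguments.
Unset Strict Implicit.
Unset Printing Implicit Defensive.

Import Order.TTheory GRing.Theory Num.Theory.
Import numFieldNormedType.Exports.

Local Open Scope classical_set_scope.
Local Open Scope ring_scope.

(** * Lebesgue measure on tuples *)

Section LebesgueTuple.
Context {R : realType}.
Local Notation T := (measurableTypeR R).

(** A constant standing for the recursively defined measure, to which its
    sigma-finiteness can be attached as a structure. *)
Definition leb n : set (n.-tuple T) -> \bar R := lebesgue_tuple n.

HB.instance Definition _ n := Measure.on (@leb n).

(** The recursion, as integration over the tail of the measure of the slice in
    the head coordinate; all inductions on the dimension go through it. *)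
Lemma leb_S n (A : set (n.+1.-tuple T)) :
  leb A = (\int[@leb n]_x lebesgue_measure
    [set y | A [the n.+1.-tuple T of y :: x]])%E.
Proof.
rewrite /leb /= /lebesgue_cons /pushforward /product_measure1 /=.
apply: eq_integral => x _ /=; congr (lebesgue_measure _).
by apply/seteqP; split => y; rewrite /xsection /= ?inE //=; move/mem_set.
Qed.

Lemma lebesgue_measure_shift (c : R) (A : set T) : measurable A ->
  lebesgue_measure [set y | A (y + c)] = lebesgue_measure A.
Proof.
move=> mA.
rewrite -[LHS]/(pushforward lebesgue_measure
  ((fun y => y + c) : _ -> measurableTypeR R) A).
apply/esym/lebesgue_measure_unique => //=.
  by apply: measurable_funD => //.
move=> _ X [[a b] _ <-] /=; rewrite /pushforward /=.
have -> : (fun y : T => y + c) @^-1` `]a, b] = `]a - c, b - c]%classic.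
  by apply/seteqP; split => y /=; rewrite !in_itv /= ltrBlDr lerBrDr.
by rewrite !lebesgue_measure_itv /= !lte_fin ltrD2r -!EFinB opprB addrA subrK.
Qed.

Definition box n (r : R) : set (n.-tuple T) :=
  [set x | forall i, `|tnth x i : R| <= r].

Lemma measurable_le n (f : n.-tuple T -> R) (r : R) :
  measurable_fun setT f -> measurable [set x | f x <= r].
Proof.
move=> mf; rewrite [X in measurable X](_ : _ = f @^-1` `]-oo, r]%classic).
  by rewrite -[X in measurable X]setTI; apply: mf.
by apply/seteqP; split => x /=; rewrite in_itv.
Qed.

Lemma measurable_gt n (f : n.-tuple T -> R) (r : R) :
  measurable_fun setT f -> measurable [set x | r < f x].
Proof.
move=> mf; rewrite [X in measurable X](_ : _ = f @^-1` `]r, +oo[%classic).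
  by rewrite -[X in measurable X]setTI; apply: mf.
by apply/seteqP; split => x /=; rewrite in_itv /= andbT.
Qed.

Lemma measurable_box n r : measurable (@box n r).
Proof.
rewrite [X in measurable X](_ : _ = \bigcap_(i in [set: 'I_n])
  [set x : n.-tuple T | `|tnth x i : R| <= r]).
  apply: fin_bigcap_measurable => // i _; apply: measurable_le.
  by apply: measurableT_comp => //; exact: measurable_tnth.
by apply/seteqP; split => x bx i; [move=> _|]; exact: bx.
Qed.

Lemma leb_box n (r : R) : 0 <= r -> leb (@box n r) = ((r *+ 2) ^+ n)%:E.
Proof.
move=> r0; elim: n => [|n IH].
  rewrite /leb /= diracE mem_set ?expr0//.
  by case.
rewrite leb_S exprS EFinM.
rewrite (eq_integral (fun x => ((r *+ 2)%:E * (\1_(@box n r) x)%:E)%E)).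
  rewrite ge0_integralZl//; last 2 first.
  - by apply/measurable_EFinP; apply: measurable_indic; exact: measurable_box.
  - by rewrite lee_fin mulrn_wge0.
  congr (_ * _)%E; rewrite integral_indic//; last exact: measurable_box.
  by rewrite setIT; exact: IH.
move=> x _; rewrite indicE.
have [bx|bx] := boolP (x \in @box n r).
  rewrite mule1; move/set_mem : bx => bx.
  have -> : [set y | @box n.+1 r [the n.+1.-tuple T of y :: x]] =
    `[- r, r]%classic.
    apply/seteqP; split => y /=.
      by move=> /(_ ord0); rewrite tnth0 in_itv /= ler_norml.
    rewrite in_itv /= -ler_norml => yr i.
    by case: (unliftP ord0 i) => [j ->|->]; rewrite ?tnthS ?tnth0.
  rewrite lebesgue_measure_itv /= lte_fin.
  case: ltP => [_|rr]; first by rewrite -EFinB opprK mulr2n.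
  have -> : r = 0 by apply/eqP; rewrite eq_le r0 andbT; lra.
  by rewrite mul0rn.
rewrite mule0 (_ : [set y | _] = set0) ?measure0//.
apply/seteqP; split => y //= byx; case/negP : bx; apply/mem_set => i.
by have := byx (lift ord0 i); rewrite tnthS.
Qed.

Lemma box_cover n : \bigcup_k (@box n k%:R) = setT.
Proof.
apply/seteqP; split=> // x _.
pose M := \sum_(i < n) `|tnth x i : R|.
exists (Num.truncn M).+1 => // i.
apply: le_trans (ltW (truncnS_gt M)).
by rewrite /M (bigD1 i)//= lerDl sumr_ge0.
Qed.

Lemma leb_sigma_finite n : sigma_finite setT (@leb n).
Proof.
exists (fun k => @box n k%:R); first by rewrite box_cover.
by move=> k; split; [exact: measurable_box|rewrite leb_box// ltry].
Qed.

HB.instance Definition _ n := @Measure_isSigmaFinite.Build _ _ _ (@leb n)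
  (@leb_sigma_finite n).

End LebesgueTuple.

(** * Euclidean inner product and reflections *)

Section DotProduct.
Context {R : realType} {n : nat}.
Implicit Types u v w : 'rV[R]_n.

Lemma dotC u v : dot u v = dot v u.
Proof. by apply: eq_bigr => i _; rewrite mulrC. Qed.

Lemma dotDl u v w : dot (u + v) w = dot u w + dot v w.
Proof.
by rewrite /dot -big_split; apply: eq_bigr => i _ /=; rewrite mxE mulrDl.
Qed.

Lemma dotZl a u w : dot (a *: u) w = a * dot u w.
Proof.
by rewrite /dot mulr_sumr; apply: eq_bigr => i _ /=; rewrite mxE mulrA.
Qed.

Lemma dotDr u v w : dot w (u + v) = dot w u + dot w v.
Proof. by rewrite dotC dotDl !(dotC w). Qed.

Lemma dotZr a u w : dot w (a *: u) = a * dot w u.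
Proof. by rewrite dotC dotZl dotC. Qed.

Lemma dotNl u w : dot (- u) w = - dot u w.
Proof. by rewrite -scaleN1r dotZl mulN1r. Qed.

Lemma dotNr u w : dot w (- u) = - dot w u.
Proof. by rewrite dotC dotNl dotC. Qed.

Lemma dotBl u v w : dot (u - v) w = dot u w - dot v w.
Proof. by rewrite dotDl dotNl. Qed.

Lemma dotBr u v w : dot w (u - v) = dot w u - dot w v.
Proof. by rewrite dotDr dotNr. Qed.

Lemma dot0l w : dot 0 w = 0.
Proof. by rewrite -(scale0r w) dotZl mul0r. Qed.

Lemma dot0r w : dot w 0 = 0.
Proof. by rewrite dotC dot0l. Qed.

Lemma dot_ge0 u : 0 <= dot u u.
Proof. by apply: sumr_ge0 => i _; rewrite -expr2 sqr_ge0. Qed.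

Lemma dot_eq0 u : (dot u u == 0) = (u == 0).
Proof.
apply/eqP/eqP => [|->]; last exact: dot0l.
move=> /eqP; rewrite psumr_eq0 => [/allP u0|i _]; last first.
  by rewrite -expr2 sqr_ge0.
apply/rowP => i; rewrite mxE; apply/eqP.
by have := u0 i (mem_index_enum _); rewrite -expr2 sqrf_eq0.
Qed.

Lemma enorm_ge0 u : 0 <= enorm u.
Proof. exact: sqrtr_ge0. Qed.

Lemma sqr_enorm u : enorm u ^+ 2 = dot u u.
Proof. by rewrite sqr_sqrtr // dot_ge0. Qed.

Lemma enorm_eq0 u : (enorm u == 0) = (u == 0).
Proof. by rewrite -sqrf_eq0 sqr_enorm dot_eq0. Qed.

Lemma enorm_gt0 u : (0 < enorm u) = (u != 0).
Proof. by rewrite lt_neqAle enorm_ge0 andbT eq_sym enorm_eq0. Qed.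

Lemma unitv_dot u : u != 0 -> dot (unitv u) (unitv u) = 1.
Proof.
move=> u0; rewrite dotZl dotZr -sqr_enorm mulrA -invfM mulVf//.
by rewrite -expr2 sqrf_eq0 enorm_eq0.
Qed.

Lemma dot_unitv_gt0 u v : v != 0 -> (0 < dot u (unitv v)) = (0 < dot u v).
Proof. by move=> v0; rewrite dotZr pmulr_rgt0// invr_gt0 enorm_gt0. Qed.

Lemma dot_unitv_lt0 u v : v != 0 -> (dot u (unitv v) < 0) = (dot u v < 0).
Proof. by move=> v0; rewrite dotZr pmulr_rlt0// invr_gt0 enorm_gt0. Qed.

(** Cauchy-Schwarz, from the square of v minus its component along u. *)
Lemma dot_le_enorm u v : dot u u = 1 -> dot u v <= enorm v.
Proof.
move=> u1; have := dot_ge0 (v - dot u v *: u).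
rewrite dotBl !dotBr !dotZl !dotZr u1 (dotC v u) => h.
have [h0|h0] := ltP (dot u v) 0; first exact: le_trans (ltW h0) (enorm_ge0 _).
rewrite -(@ler_pXn2r _ 2) ?nnegrE ?enorm_ge0// sqr_enorm expr2; lra.
Qed.

Lemma enormZ k u : 0 <= k -> enorm (k *: u) = k * enorm u.
Proof.
move=> k0; rewrite /enorm dotZl dotZr mulrA -expr2 sqrtrM ?sqr_ge0//.
by rewrite sqrtr_sqr ger0_norm.
Qed.

Lemma enormB u v : enorm (u - v) = enorm (v - u).
Proof. by rewrite /enorm -opprB dotNl dotNr opprK. Qed.

(** Orthogonal reflection in the hyperplane perpendicular to w.  For w = 0 the
    quotient is 0 and this is the identity, so refl_swap covers u = v as well. *)
Definition refl w v := v - (2 * dot v w / dot w w) *: w.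

Lemma reflD w : {morph refl w : u v / u + v}.
Proof.
move=> u v; rewrite /refl dotDl mulrDr mulrDl scalerDl.
by rewrite opprD addrACA.
Qed.

Lemma refl_dotw w v : dot (refl w v) w = - dot v w.
Proof.
rewrite dotBl dotZl; have [->|w0] := eqVneq w 0.
  by rewrite !dot0l !dot0r; ring.
by field; rewrite dot_eq0.
Qed.

Lemma reflK w : involutive (refl w).
Proof.
move=> v; rewrite {1}/refl refl_dotw /refl -addrA -opprD -scalerDl.
by rewrite mulrN mulNr addrN scale0r oppr0 addr0.
Qed.

Lemma refl_dot w u v : dot (refl w u) (refl w v) = dot u v.
Proof.
rewrite {2}/refl dotBr dotZr refl_dotw /refl dotBl dotZl (dotC w v).
by have [->|w0] := eqVneq w 0; ring.
Qed.

Lemma reflN w v : refl w (- v) = - refl w v.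
Proof.
by rewrite -[LHS]addr0 -(subrr (refl w v)) addrA -reflD addNr /refl dot0l
  mulr0 mul0r scale0r subr0 sub0r.
Qed.

Lemma refl_swap u v : dot u u = dot v v -> refl (u - v) u = v.
Proof.
move=> uv; have [->|w0] := eqVneq u v.
  by rewrite subrr /refl scaler0 subr0.
have w2 : dot (u - v) (u - v) != 0 by rewrite dot_eq0 subr_eq0.
have e : 2 * dot u (u - v) = dot (u - v) (u - v).
  by rewrite !dotBr !dotBl uv (dotC v u); ring.
by rewrite /refl e divff// scale1r opprB addrC subrK.
Qed.

Lemma refl_fix w v : dot v w = 0 -> refl w v = v.
Proof. by move=> vw; rewrite /refl vw mulr0 mul0r scale0r subr0. Qed.

Lemma refl_enorm w v : enorm (refl w v) = enorm v.
Proof. by rewrite /enorm refl_dot. Qed.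

End DotProduct.

(** * Translations and the unit ball *)

Section Isometries.
Context {R : realType}.
Local Notation T := (measurableTypeR R).

(** Measures live on tuples and linear algebra on row vectors; [lift_row] carries
    maps from the latter to the former. *)
Definition tuple_of_row n (v : 'rV[R]_n) : n.-tuple T := [tuple v ord0 i | i < n].

Lemma row_of_tupleK n : cancel (@row_of_tuple R n) (@tuple_of_row n).
Proof. by move=> x; apply: eq_from_tnth => i; rewrite tnth_mktuple mxE. Qed.

Lemma tuple_of_rowK n : cancel (@tuple_of_row n) (@row_of_tuple R n).
Proof. by move=> x; apply/rowP => i; rewrite mxE tnth_mktuple. Qed.

Definition lift_row n (phi : 'rV[R]_n -> 'rV[R]_n) (x : n.-tuple T) : n.-tuple T :=
  tuple_of_row (phi (row_of_tuple x)).

Lemma measurable_rowP d (X : measurableType d) n (f : X -> n.-tuple T) :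
  (forall i, measurable_fun setT (fun x => row_of_tuple (f x) ord0 i : T)) ->
  measurable_fun setT f.
Proof.
move=> H; apply/measurable_fun_tnthP => i.
by have := H i; apply: eq_measurable_fun => x _ /=; rewrite mxE.
Qed.

Lemma measurable_rowE d (X : measurableType d) n (f : X -> n.-tuple T) i :
  measurable_fun setT f ->
  measurable_fun setT (fun x => row_of_tuple (f x) ord0 i : T).
Proof.
move=> /measurable_fun_tnthP /(_ i).
by apply: eq_measurable_fun => x _ /=; rewrite mxE.
Qed.

Lemma measurable_dot n (v : 'rV[R]_n) :
  measurable_fun setT (fun x : n.-tuple T => dot (row_of_tuple x) v).
Proof.
apply: measurable_sum => i; apply: measurable_funM => //.
exact: measurable_rowE.
Qed.

Lemma measurable_dot2 n :
  measurable_fun setT (fun x : n.-tuple T => dot (row_of_tuple x) (row_of_tuple x)).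
Proof.
apply: measurable_sum => i; apply: measurable_funM => //; exact: measurable_rowE.
Qed.

Lemma unit_ballE n : @unit_ball R n = [set x | dot (row_of_tuple x) (row_of_tuple x) <= 1].
Proof.
apply/seteqP; split => x /=; rewrite /unit_ball /=.
  by move=> x1; rewrite -sqr_enorm -(expr1n _ 2) lerXn2r ?nnegrE ?enorm_ge0.
by move=> x1; rewrite -sqrtr1 ler_wsqrtr.
Qed.

Lemma measurable_unit_ball n : measurable (@unit_ball R n).
Proof. rewrite unit_ballE; apply: measurable_le; exact: measurable_dot2. Qed.

Lemma unit_ball_lty n : (leb (@unit_ball R n) < +oo)%E.
Proof.
apply: (@le_lt_trans _ _ (leb (@box R n 1))); last by rewrite leb_box// ltry.
apply: le_measure; rewrite ?inE; [exact: measurable_unit_ball|exact: measurable_box|].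
rewrite unit_ballE => x /= x1 i.
rewrite -(@ler_pXn2r _ 2) ?nnegrE// expr1n real_normK ?num_real//.
apply: le_trans x1; rewrite /dot (bigD1 i)//= mxE -expr2 lerDl.
by apply: sumr_ge0 => j _; rewrite -expr2 sqr_ge0.
Qed.

Lemma unit_ball_gt0 n : (0 < leb (@unit_ball R n))%E.
Proof.
apply: (@lt_le_trans _ _ (leb (@box R n (n.+1%:R^-1)))).
  by rewrite leb_box// lte_fin exprn_gt0// pmulrn_lgt0// invr_gt0.
apply: le_measure; rewrite ?inE; [exact: measurable_box|exact: measurable_unit_ball|].
rewrite unit_ballE => x /= bx.
apply: (@le_trans _ _ (\sum_(i < n) (n.+1%:R^-1 : R))); last first.
  by rewrite sumr_const card_ord -[leLHS]mulr_natl ler_pdivrMr// mul1r ler_nat.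
apply: ler_sum => i _; rewrite mxE.
have := bx i; set t : R := tnth x i => ht.
have : t * t <= `|t| * 1.
  rewrite (le_trans (ler_norm _))// normrM ler_wpM2l//.
  by rewrite (le_trans ht)// invf_le1// ler1n.
by move/le_trans; apply; rewrite mulr1.
Qed.

Definition shift_tuple n (c : 'rV[R]_n) := lift_row (fun v => v + c).

Lemma measurable_shift n (c : 'rV[R]_n) : measurable_fun setT (shift_tuple c).
Proof.
apply: measurable_rowP => i.
rewrite (_ : (fun _ => _) = fun x => row_of_tuple x ord0 i + c ord0 i); last first.
  by apply/funext => x; rewrite /shift_tuple /lift_row tuple_of_rowK mxE.
by apply: measurable_funD => //; exact: measurable_rowE.
Qed.

Lemma measurable_preim d (X : measurableType d) d' (Y : measurableType d') (f : X -> Y) A :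
  measurable_fun setT f -> measurable A -> measurable (f @^-1` A).
Proof. by move=> mf mA; rewrite -[X in measurable X]setTI; exact: mf. Qed.

Lemma measurable_slice n (A : set (n.+1.-tuple T)) : measurable A ->
  measurable_fun setT (fun x : n.-tuple T => lebesgue_measure
    ([set y | A [the n.+1.-tuple T of y :: x]] : set T)).
Proof.
move=> mA.
have := @measurable_fun_xsection _ _ (n.-tuple T) T R lebesgue_measure _
  (measurable_preim (@measurable_cons _ _ _ _ (@snd (n.-tuple T) T) n fst
    measurable_snd measurable_fst) mA).
apply: eq_measurable_fun => x _ /=; congr (lebesgue_measure _).
by apply/seteqP; split => y; rewrite /xsection /= ?inE //; move/mem_set.
Qed.

(** By induction on the dimension: translate the head inside each slice, then the
    tail under the integral. *)
Lemma leb_shift n (c : 'rV[R]_n) A : measurable A ->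
  leb (shift_tuple c @^-1` A) = leb A.
Proof.
elim: n c A => [|n IH] c A mA.
  congr leb; apply/seteqP; split => x /=;
  by rewrite (_ : shift_tuple c x = x)//; apply: eq_from_tnth => -[].
rewrite !leb_S.
pose c' : 'rV_n := \row_i c ord0 (lift ord0 i).
pose G (x : n.-tuple T) := lebesgue_measure
    ([set y | A [the n.+1.-tuple T of y :: x]] : set T).
transitivity (\int[@leb R n]_x (G \o shift_tuple c') x)%E.
  apply: eq_integral => x _.
  rewrite /= /G -[RHS](@lebesgue_measure_shift _ (c ord0 ord0)); last first.
    pose z := shift_tuple c' x.
    apply: (@measurable_preim _ _ _ _ (fun y : T => [the _.-tuple T of y :: z]) _ _ mA).
    exact: (@measurable_cons _ _ _ _ id _ (cst z)).
  congr (lebesgue_measure _); apply/seteqP; split => y /=;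
  congr A; apply: eq_from_tnth => i; rewrite tnth_mktuple !mxE;
  by case: (unliftP ord0 i) => [j ->|->]; rewrite ?tnthS ?tnth0 // tnth_mktuple !mxE.
have := @ge0_integral_pushforward _ _ _ _ _ _ (measurable_shift c') (@leb R n)
  setT G measurableT (measurable_slice mA) (fun _ _ => measure_ge0 _ _).
rewrite preimage_setT => <-.
apply: eq_measure_integral => [|? B mB _]; first exact: measurable_shift.
exact: IH.
Qed.

End Isometries.

(** * Invariance under reflections *)

Section Invariance.
Context {R : realType}.
Local Notation T := (measurableTypeR R).

Lemma measurable_lift_refl n (w : 'rV[R]_n) : measurable_fun setT (lift_row (refl w)).
Proof.
apply: measurable_rowP => i.
rewrite (_ : (fun _ => _) = fun x => row_of_tuple x ord0 i -
   2 * dot (row_of_tuple x) w / dot w w * w ord0 i); last first.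
  by apply/funext => x; rewrite /lift_row tuple_of_rowK !mxE.
apply: measurable_funB; first exact: measurable_rowE.
apply: measurable_funM => //; apply: measurable_funM => //; apply: measurable_funM => //.
exact: measurable_dot.
Qed.

(** Tonelli for the indicator of E. *)
Lemma slice_swap n (E : set (n.-tuple T * n.-tuple T)) : measurable E ->
  (\int[@leb R n]_x leb [set y | E (x, y)] = \int[@leb R n]_y leb [set x | E (x, y)])%E.
Proof.
move=> mE.
have mu := @product_measure_unique _ _ _ _ R (@leb R n) (@leb R n).
transitivity ((@leb R n \x @leb R n) E)%E.
  apply: eq_integral => x _ /=; congr (leb _).
  by apply/seteqP; split => y; rewrite /xsection /= ?inE //; move/set_mem.
rewrite (mu ((@leb R n) \x^ (@leb R n))%E)//=; last first.
  by move=> *; rewrite product_measure2E.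
apply: eq_integral => x _ /=; congr (leb _).
by apply/seteqP; split => y; rewrite /ysection /= ?inE //; move/set_mem.
Qed.

(** The uniqueness argument for Haar measure.  With Q the reflection and A the
    unit ball, compute in two orders the measure of the pairs (x, y) with Qx in A
    and y + Qx in B.  Integrating over y first gives |B| |A|; translating x by -Qy
    first turns the conditions into Qx - y in A and Qx in B, which gives
    |A| |Q^-1 B|, because A is symmetric and invariant under Q. *)
Lemma leb_refl n (w : 'rV[R]_n) B : measurable B ->
  leb (lift_row (refl w) @^-1` B) = leb B.
Proof.
move=> mB.
pose A := @unit_ball R n; pose Q := lift_row (n := n) (refl w).
have mA : measurable A := @measurable_unit_ball R n.
have mQ : measurable_fun setT Q := measurable_lift_refl w.
have QA : Q @^-1` A = A.
  by apply/seteqP; split => x; rewrite /A /unit_ball /= /Q /lift_row tuple_of_rowK refl_enorm.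
pose add (p : n.-tuple T * n.-tuple T) :=
  tuple_of_row (row_of_tuple p.1 + row_of_tuple p.2).
have madd d (X : measurableType d) (f g : X -> n.-tuple T) :
   measurable_fun setT f -> measurable_fun setT g ->
   measurable_fun setT (fun p => add (f p, g p)).
  move=> mf mg; apply: measurable_rowP => i.
  rewrite (_ : (fun _ => _) = fun x => row_of_tuple (f x) ord0 i +
    row_of_tuple (g x) ord0 i); last first.
    by apply/funext => x; rewrite tuple_of_rowK !mxE.
  by apply: measurable_funD; exact: measurable_rowE.
pose opp (x : n.-tuple T) := tuple_of_row (- row_of_tuple x).
have mopp : measurable_fun setT opp.
  apply: measurable_rowP => i.
  rewrite (_ : (fun _ => _) = fun x => - (row_of_tuple x ord0 i)); last first.
    by apply/funext => x; rewrite tuple_of_rowK !mxE.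
  by apply: measurable_funN; exact: measurable_rowE.
have mQ1 : measurable_fun setT (fun p : n.-tuple T * n.-tuple T => Q p.1).
  exact: measurableT_comp mQ _.
have shiftE c : shift_tuple c = fun x => add (x, tuple_of_row c).
  by apply/funext => x; rewrite /add /shift_tuple /lift_row /= tuple_of_rowK.
pose E := [set p : n.-tuple T * n.-tuple T | A (Q p.1) /\ B (add (p.2, Q p.1))].
pose E' := [set p : n.-tuple T * n.-tuple T | A (add (Q p.1, opp p.2)) /\ B (Q p.1)].
have mE : measurable E.
  apply: measurableI; first exact: (measurable_preim mQ1).
  by apply: (@measurable_preim _ _ _ _ (fun p => add (p.2, Q p.1))) => //; exact: madd.
have mE' : measurable E'.
  apply: measurableI; last exact: (measurable_preim mQ1).
  apply: (@measurable_preim _ _ _ _ (fun p => add (Q p.1, opp p.2))) => //.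
  by apply: madd => //; exact: measurableT_comp mopp _.
have E1 : (\int[@leb R n]_x leb [set y | E (x, y)] = leb B * leb A)%E.
  rewrite (eq_integral (fun x => (leb B * (\1_(Q @^-1` A) x)%:E)%E)).
    rewrite QA ge0_integralZl//; last first.
      by apply/measurable_EFinP; exact: measurable_indic.
    congr (_ * _)%E; rewrite integral_indic// setIT//.
  move=> x _; rewrite indicE /E /=.
  have [QAx|QAx] := boolP (x \in Q @^-1` A).
    move/set_mem : QAx => /= QAx.
    rewrite mule1 -(leb_shift (row_of_tuple (Q x)) mB); congr (leb _).
    by apply/seteqP; split => y /=; rewrite shiftE row_of_tupleK //; case.
  rewrite mule0 (_ : [set y | _] = set0) ?measure0//.
  by apply/seteqP; split => y //= -[AQ]; case/negP : QAx; apply/mem_set.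
have E2 : (\int[@leb R n]_x leb [set y | E' (x, y)] =
    leb A * leb (Q @^-1` B))%E.
  rewrite (eq_integral (fun x => (leb A * (\1_(Q @^-1` B) x)%:E)%E)).
    rewrite ge0_integralZl//; last first.
      by apply/measurable_EFinP; apply: measurable_indic; exact: measurable_preim.
    congr (_ * _)%E; rewrite integral_indic// ?setIT//; exact: measurable_preim.
  move=> x _; rewrite indicE /E' /=.
  have [QAx|QAx] := boolP (x \in Q @^-1` B).
    move/set_mem : QAx => /= QAx.
    rewrite mule1 -(leb_shift (- row_of_tuple (Q x)) mA); congr (leb _).
    have dB (a b : 'rV[R]_n) : dot (a - b) (a - b) = dot (b - a) (b - a).
      by rewrite -opprB dotNl dotNr opprK.
    by apply/seteqP; split => y /=; rewrite shiftE /A unit_ballE /= /add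
      /opp /= !tuple_of_rowK dB => // -[].
  rewrite mule0 (_ : [set y | _] = set0) ?measure0//.
  by apply/seteqP; split => y //= -[_ AQ]; case/negP : QAx; apply/mem_set.
have E12 : (leb B * leb A = leb A * leb (Q @^-1` B))%E.
  rewrite -E1 -E2 !slice_swap//; apply: eq_integral => y _.
  have mEy : measurable [set x | E (x, y)].
    exact: (@measurable_preim _ _ _ _ (fun x => (x, y))).
  rewrite -(leb_shift (- refl w (row_of_tuple y)) mEy); congr (leb _).
  apply/seteqP; split => x /=; rewrite shiftE /E /E' /= /add /Q /lift_row /opp /=
     !tuple_of_rowK reflD reflN reflK addrC => -[h1 h2]; split => //.
  - by move: h2; rewrite addrA subrr add0r.
  - by rewrite addrA subrr add0r.
have Af : leb A \is a fin_num.
  by rewrite ge0_fin_numE ?measure_ge0//; exact: unit_ball_lty.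
have A0 : (0 < leb A)%E := @unit_ball_gt0 R n.
move: E12; rewrite muleC => E12; apply/eqP.
by rewrite eq_le -(@lee_pmul2l _ (leb A))// -[X in _ && X](@lee_pmul2l _ (leb A))// E12 lexx.
Qed.

(** A reflection moves the hyperplane to a coordinate hyperplane, whose slices are
    single points. *)
Lemma leb_hyperplane n (v : 'rV[R]_n) : v != 0 ->
  leb [set x : n.-tuple T | dot (row_of_tuple x) v = 0] = 0%E.
Proof.
case: n v => [v|n v v0]; first by rewrite thinmx0 eqxx.
pose e0 : 'rV[R]_n.+1 := delta_mx ord0 ord0.
have xe0 y : dot y e0 = y ord0 ord0.
  rewrite /dot (bigD1 ord0)//= big1 ?addr0 ?mxE ?eqxx ?mulr1// => i i0.
  by rewrite mxE eqxx (negbTE i0) mulr0.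
pose w := unitv v - e0.
pose B := [set x : n.+1.-tuple T | tnth x ord0 = 0 :> R].
have mB : measurable B.
  apply: (@measurable_preim _ _ _ _ (fun x : n.+1.-tuple T => tnth x ord0 : T) [set 0]) => //.
  exact: measurable_tnth.
rewrite (_ : [set x | _] = lift_row (refl w) @^-1` B).
  rewrite leb_refl// leb_S integral0_eq// => x _.
  rewrite (_ : [set y | _] = [set 0]) ?lebesgue_measure_set1//.
have we0 : refl w (unitv v) = e0.
  by apply: refl_swap; rewrite unitv_dot// xe0 mxE !eqxx.
have iv0 : (enorm v)^-1 != 0 by rewrite invr_eq0 enorm_eq0.
apply/seteqP; split => x; rewrite /B /lift_row /= tnth_mktuple -xe0 -we0 refl_dot dotZr.
  by move=> ->; rewrite mulr0.
by move/eqP; rewrite mulf_eq0 (negbTE iv0) => /eqP.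
Qed.

End Invariance.

(** * Uniform measure on directions and lunes *)

Section Sinusoid.
Context {R : realType}.
Variables p q : R.
Let f (t : R) := p * cos t + q * sin t.

(** Ptolemy-like linear relation between three values of a sinusoid. *)
Let sinusoid_convex x y z :
  f y * sin (z - x) = f x * sin (z - y) + f z * sin (y - x).
Proof.
rewrite /f !sinB.
move: (cos x) (sin x) (cos y) (sin y) (cos z) (sin z) => cx sx cy sy cz sz.
ring.
Qed.

(** Two positive values enclosing a negative one are more than half a period
    apart, since within half a period the middle value is a positive combination of
    the outer ones. *)
Let sinusoid_gap x y z : x < y -> y < z -> 0 < f x -> f y < 0 -> 0 < f z ->
  pi < z - x.
Proof.
move=> xy yz fx fy fz; rewrite ltNge; apply/negP => zx.
have [zx'|zx'] := eqVneq (z - x) pi.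
  have : f z = - f x.
    have -> : z = x + pi by rewrite -zx' addrC subrK.
    by rewrite /f cosDpi sinDpi; ring.
  by move=> e; move: fz; rewrite e oppr_gt0; lra.
have {}zx' : z - x < pi by rewrite lt_neqAle zx'.
have s1 : 0 < sin (z - x) by apply: sin_gt0_pi; rewrite zx'; lra.
have s2 : 0 < sin (z - y) by apply: sin_gt0_pi; apply/andP; split; lra.
have s3 : 0 < sin (y - x) by apply: sin_gt0_pi; apply/andP; split; lra.
have := sinusoid_convex x y z.
have : f y * sin (z - x) < 0 by rewrite nmulr_rlt0.
have : 0 < f x * sin (z - y) by rewrite mulr_gt0.
have : 0 < f z * sin (y - x) by rewrite mulr_gt0.
lra.
Qed.

(** The gaps from a to c and from c to a + 2 pi would both exceed pi. *)
Lemma sinusoid_sign_changes a b c d :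
  a < b -> b <= c -> c < d -> d <= a + pi *+ 2 ->
  0 < f a -> f b < 0 -> 0 < f c -> f d < 0 -> False.
Proof.
move=> ab bc cd da fa fb fc fd.
have {}bc : b < c.
  by rewrite lt_neqAle bc andbT; apply/eqP => e; move: fc; rewrite -e; lra.
have g1 := sinusoid_gap ab bc fa fb fc.
have fa' : f (a + pi *+ 2) = f a by rewrite /f cosD2pi sinD2pi.
have {}da : d < a + pi *+ 2.
  rewrite lt_neqAle da andbT; apply/eqP => e.
  by move: fd; rewrite e fa'; lra.
have := sinusoid_gap cd da fc fd; rewrite fa' => /(_ fa).
by rewrite mulr2n; lra.
Qed.

End Sinusoid.

Section SphereMeasure.
Context {R : realType}.
Local Notation T := (measurableTypeR R).

Let vol n : R := fine (leb (@unit_ball R n)).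

Let vol_fin n : leb (@unit_ball R n) \is a fin_num.
Proof. by rewrite ge0_fin_numE ?measure_ge0//; exact: unit_ball_lty. Qed.

Let vol_gt0 n : 0 < vol n.
Proof. by rewrite -lte_fin fineK//; exact: unit_ball_gt0. Qed.

Let vol_inv_ge0 n : 0 <= (vol n)^-1.
Proof. by rewrite invr_ge0 ltW. Qed.

(** Normalized Lebesgue measure on the unit ball.  Everything integrated against
    it depends only on the direction of x, so it plays the role of the uniform
    measure on the sphere while staying on the space of tuples. *)
Definition sph n : set (n.-tuple T) -> \bar R :=
  mscale (NngNum (vol_inv_ge0 n)) (mrestr (@leb R n) (@measurable_unit_ball R n)).

HB.instance Definition _ n := Measure.on (@sph n).

Lemma sphE n (A : set (n.-tuple T)) :
  sph A = ((vol n)^-1%:E * leb (A `&` @unit_ball R n))%E.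
Proof. by []. Qed.

Lemma sph_setT n : sph [set: n.-tuple T] = 1%E.
Proof.
by rewrite sphE setTI -(fineK (@vol_fin n)) -EFinM mulVf// gt_eqF.
Qed.

Lemma sph_le1 n (A : set (n.-tuple T)) : measurable A -> (sph A <= 1)%E.
Proof. by move=> mA; rewrite -(sph_setT n); apply: le_measure; rewrite ?inE. Qed.

Lemma sph_fin n (A : set (n.-tuple T)) : measurable A -> sph A \is a fin_num.
Proof.
move=> mA; rewrite ge0_fin_numE ?measure_ge0//.
by rewrite (le_lt_trans (sph_le1 mA))// ltry.
Qed.

Lemma sph_hyperplane n (v : 'rV[R]_n) : v != 0 ->
  sph [set x : n.-tuple T | dot (row_of_tuple x) v = 0] = 0%E.
Proof.
move=> v0; rewrite sphE.
suff -> : leb ([set x | dot (row_of_tuple x) v = 0] `&` @unit_ball R n) = 0%E.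
  by rewrite mule0.
have mH : measurable [set x : n.-tuple T | dot (row_of_tuple x) v = 0].
  exact: (measurable_preim (measurable_dot v) (measurable_set1 0)).
apply/eqP; rewrite eq_le measure_ge0 andbT -(leb_hyperplane v0).
apply: le_measure; rewrite ?inE//.
by apply: measurableI => //; exact: measurable_unit_ball.
Qed.

(** For a function of the direction only, as are all functions of the signs of
    <x, v>, no normalization of x is needed. *)
Lemma sphere_averageE n (F : 'rV[R]_n -> R) (G : n.-tuple T -> R) :
  (forall x, F (unitv (row_of_tuple x)) = G x) -> (forall x, 0 <= G x) ->
  measurable_fun setT G ->
  sphere_average F = (\int[@sph n]_x (G x)%:E)%E.
Proof.
move=> FG G0 mG.
have mE : measurable_fun setT (EFin \o G) by exact/measurable_EFinP.
have mB := @measurable_unit_ball R n.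
rewrite ge0_integral_mscale//=; last by move=> x _; rewrite lee_fin.
rewrite /sphere_average; congr (_ * _)%E.
rewrite [RHS](_ : _ = \int[mrestr (@leb R n) mB]_(x in @unit_ball R n `|` ~` @unit_ball R n) (G x)%:E)%E; last by rewrite setUv.
rewrite ge0_integral_setU//=; last 4 first.
- exact: measurableC.
- by rewrite setUv.
- by move=> x _; rewrite lee_fin.
- by apply/disj_setPS; rewrite setICr.
rewrite [X in (_ + X)%E](_ : _ = 0%E) ?adde0; last first.
  apply: null_set_integral => //=; first exact: measurableC.
  - by apply: measurable_funS mE.
  - by rewrite /mrestr setICl measure0.
transitivity (\int[@leb R n]_(x in @unit_ball R n) (G x)%:E)%E.
  by apply: eq_integral => x _; rewrite FG.
by apply: eq_measure_integral => A mA AB; rewrite /= /mrestr setIidl.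
Qed.

Definition lune n (u v : 'rV[R]_n) : set (n.-tuple T) :=
  [set x | 0 < dot (row_of_tuple x) u /\ dot (row_of_tuple x) v < 0].

Lemma measurable_lune n (u v : 'rV[R]_n) : measurable (lune u v).
Proof.
rewrite (_ : lune u v = [set x | 0 < dot (row_of_tuple x) u] `&`
   [set x | 0 < dot (row_of_tuple x) (- v)]); last first.
  by apply/seteqP; split => x; rewrite /lune /= dotNr oppr_gt0.
by apply: measurableI; apply: measurable_gt; exact: measurable_dot.
Qed.

Lemma sph_lune_refl n (w u v : 'rV[R]_n) :
  sph (lune (refl w u) (refl w v)) = sph (lune u v).
Proof.
rewrite !sphE; congr (_ * _)%E.
have mD : measurable (lune (refl w u) (refl w v) `&` @unit_ball R n).
  by apply: measurableI; [exact: measurable_lune|exact: measurable_unit_ball].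
rewrite -(leb_refl w mD); congr leb.
by apply/seteqP; split => x; rewrite /lune /unit_ball /= /lift_row tuple_of_rowK
  !refl_dot refl_enorm.
Qed.

(** A product of two reflections carries one pair to the other: the first moves u to
    u', and the second moves the image of v to v' while fixing u'. *)
Lemma sph_lune_dot n (u v u' v' : 'rV[R]_n) :
  dot u u = 1 -> dot v v = 1 -> dot u' u' = 1 -> dot v' v' = 1 ->
  dot u v = dot u' v' -> sph (lune u v) = sph (lune u' v').
Proof.
move=> uu vv uu' vv' uv.
rewrite -(sph_lune_refl (u - u') u v) refl_swap ?uu'//.
set v1 := refl _ v.
have vv1 : dot v1 v1 = 1 by rewrite refl_dot.
have uv1 : dot u' v1 = dot u' v'.
  by rewrite -uv -[in LHS](refl_swap (u := u) (v := u')) ?uu'// refl_dot.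
rewrite -(sph_lune_refl (v1 - v') u' v1) refl_swap ?vv1// refl_fix//.
by rewrite dotBr uv1 subrr.
Qed.

(** Along the great circle through u and w the product with x is a sinusoid of the
    angle, so x lies in at most one of K consecutive lunes. *)
Lemma sph_lune_circle n (u w : 'rV[R]_n) (t : R) (K : nat) :
  dot u u = 1 -> dot w w = 1 -> dot u w = 0 -> 0 < t -> K%:R * t <= pi *+ 2 ->
  (K%:R%:E * sph (lune u (cos t *: u + sin t *: w)) <= 1)%E.
Proof.
move=> uu ww uw t0 Kt.
pose c a := cos a *: u + sin a *: w.
have cdot a b : dot (c a) (c b) = cos (a - b).
  rewrite cosB /c !dotDl !dotDr !dotZl !dotZr uu ww (dotC w u) uw.
  ring.
pose F (j : 'I_K) := lune (c (j%:R * t)) (c (j.+1%:R * t)).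
have LF j : sph (F j) = sph (lune u (c t)).
  have c0 : c 0 = u by rewrite /c cos0 sin0 scale1r scale0r addr0.
  rewrite -[in RHS]c0.
  apply: sph_lune_dot; rewrite !cdot ?subrr ?cos0//.
  by congr cos; rewrite -natr1; ring.
have mF j : measurable (F j) by exact: measurable_lune.
have tF : trivIset setT F.
  have wl (i j : 'I_K) : (i < j)%N -> F i `&` F j !=set0 -> False.
    move=> ij [x [[i1 i2] [j1 j2]]].
    move: i1 i2 j1 j2; rewrite /c !dotDr !dotZr => i1 i2 j1 j2.
    apply: (@sinusoid_sign_changes R (dot (row_of_tuple x) u)
      (dot (row_of_tuple x) w) (i%:R * t) (i.+1%:R * t) (j%:R * t) (j.+1%:R * t)).
    - by rewrite ltr_pM2r// ltr_nat.
    - by rewrite ler_pM2r// ler_nat.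
    - by rewrite ltr_pM2r// ltr_nat.
    - apply: (@le_trans _ _ (K%:R * t)); first by rewrite ler_pM2r// ler_nat.
      by rewrite (le_trans Kt)// lerDr mulr_ge0// ltW.
    - by move: i1; apply: etrans; congr (0 < _); ring.
    - by move: i2; apply: etrans; congr (_ < 0); ring.
    - by move: j1; apply: etrans; congr (0 < _); ring.
    - by move: j2; apply: etrans; congr (_ < 0); ring.
  move=> i j _ _ ij; have [h|h|/val_inj//] := ltngtP i j.
    by exfalso; exact: wl h ij.
  by exfalso; apply: wl h _; rewrite setIC.
have := measure_bigsetU_ord (@sph n) xpredT mF tF.
rewrite (eq_bigr _ (fun j _ => LF j)) -/(c t).
rewrite -(fineK (sph_fin (measurable_lune u (c t)))) sumEFin sumr_const card_ord.
rewrite -EFinM mulr_natl => <-; apply: sph_le1.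
by apply: bigsetU_measurable.
Qed.

Lemma unit_dot_bounds n (u v : 'rV[R]_n) : dot u u = 1 -> dot v v = 1 ->
  -1 <= dot u v <= 1.
Proof.
move=> uu vv; have nv : enorm v = 1 by rewrite /enorm vv sqrtr1.
apply/andP; split; last by rewrite -nv dot_le_enorm.
have := @dot_le_enorm _ _ (- u) v.
by rewrite nv !dotNl dotNr opprK uu => /(_ erefl); lra.
Qed.

(** sin x / x tends to 1. *)
Lemma sin_ge_near0 (e : R) : 0 < e ->
  exists2 d, 0 < d & forall x, 0 < x < d -> (1 - e) * x <= sin x.
Proof.
move=> e0.
have h : h^-1 *: (sin (h *: 1 + 0) - sin 0 : R) @[h --> (0 : R)^'] --> (1 : R).
  have [dv dE] := @is_derive_sin R 0.
  by rewrite -[X in _ --> X]cos0 -dE; exact: dv.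
move/cvgrPdist_le : h => /(_ _ e0)[d /= d0 H].
exists d => // x /andP[x0 xd].
have := H x; rewrite /ball_/= sub0r normrN gtr0_norm// => /(_ xd).
rewrite gt_eqF// => /(_ isT).
rewrite sin0 subr0 addr0 /GRing.scale /= mulr1 => h.
have {}h : 1 - x^-1 * sin x <= e by apply: le_trans (ler_norm _) h.
have : (1 - e) <= sin x / x by rewrite mulrC; lra.
by rewrite ler_pdivlMr.
Qed.

(** K congruent lunes of angle t fit around the circle as soon as K t <= 2 pi,
    so each has measure at most 1/K, which is t / 2pi up to a factor tending
    to 1 with t; and the chord is also asymptotic to t. *)
Lemma sph_lune_chord (e : R) : 0 < e -> exists2 d, 0 < d &
  forall n (u v : 'rV[R]_n), dot u u = 1 -> dot v v = 1 -> enorm (u - v) < d ->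
  ((pi *+ 2)%:E * sph (lune u v) <= ((1 + e) * enorm (u - v))%:E)%E.
Proof.
move=> e0; pose a := e / (2 + e).
have a0 : 0 < a by rewrite divr_gt0//; lra.
have a1 : a < 1 by rewrite ltr_pdivrMr; lra.
(* one factor 1 + a comes from rounding 2 pi / t down to K, one factor 1 - a from
   comparing the chord 2 sin (t / 2) with t *)
have ae : (1 + a) <= (1 + e) * (1 - a).
  have : a * (2 + e) = e by rewrite /a divfK//; apply: lt0r_neq0; lra.
  by nra.
have pi0 := @pi_gt0 R.
have [d0 d00 sinlb] := sin_ge_near0 a0.
pose M := (Num.truncn a^-1).+1.
have M0 : 0 < M%:R :> R by [].
have aM : a^-1 < M%:R := truncnS_gt a^-1.
pose b := Num.min (d0 / 2) (Num.min (pi / 2) (pi / M%:R)).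
have b0 : 0 < b by rewrite !lt_min !divr_gt0.
have bpi : b <= pi / 2 by rewrite !ge_min lexx orbT.
have bd0 : b <= d0 / 2 by rewrite !ge_min lexx.
have bM : b <= pi / M%:R by rewrite !ge_min lexx !orbT.
clearbody M b.
have sb0 : 0 < sin b by apply: sin_gt0_pi; rewrite b0; lra.
exists (2 * sin b); first by rewrite mulr_gt0.
move=> n u v uu vv uvd.
have /andP[l1 l2] := unit_dot_bounds uu vv.
pose t := acos (dot u v).
have ct : cos t = dot u v by rewrite acosK// in_itv /= l1.
have t_ge0 : 0 <= t by apply: acos_ge0; rewrite l1.
have t_le : t <= pi by apply: acos_lepi; rewrite l1.
have dE : enorm (u - v) = 2 * sin (t / 2).
  have s0 : 0 <= sin (t / 2) by apply: sin_ge0_pi; apply/andP; split; lra.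
  apply/eqP; rewrite -(@eqrXn2 _ 2)// ?enorm_ge0 ?mulr_ge0//.
  rewrite sqr_enorm dotBl !dotBr uu vv (dotC v u) -ct.
  rewrite exprMn [X in cos X](_ : t = t / 2 + t / 2); last by field.
  rewrite cosD; have := cos2Dsin2 (t / 2); move: (cos _) (sin _) => x y h.
  by apply/eqP; nra.
have tb : t / 2 < b.
  rewrite ltNge; apply/negP => bt.
  have : sin b <= sin (t / 2).
    rewrite leNgt ltr_sin ?in_itv /=; last 2 first.
    1-2: by apply/andP; split; lra.
    by rewrite -leNgt.
  by move: uvd; rewrite dE; lra.
have [t0|t0] := eqVneq t 0.
  have -> : lune u v = set0.
    have : enorm (u - v) = 0 by rewrite dE t0 mul0r sin0 mulr0.
    move/eqP; rewrite enorm_eq0 subr_eq0 => /eqP ->.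
    by apply/seteqP; split => x // -[]; lra.
  by rewrite measure0 mule0 lee_fin mulr_ge0 ?enorm_ge0//; lra.
have {}t0 : 0 < t by rewrite lt_neqAle eq_sym t0.
have s0 : 0 < sin t by apply: sin_gt0_pi; rewrite t0; lra.
pose w := (sin t)^-1 *: (v - cos t *: u).
have uw : dot u w = 0.
  by rewrite /w dotZr dotBr dotZr uu mulr1 ct subrr mulr0.
have ww : dot w w = 1.
  rewrite /w dotZr dotZl !dotBr !dotBl !dotZr !dotZl uu vv (dotC v u) -ct.
  have := cos2Dsin2 t; move: (cos t) (sin t) s0 => x y y0 h.
  have -> : 1 - x * x - (x * x - x * (x * 1)) = y ^+ 2 by lra.
  by field; apply: lt0r_neq0.
(* u and w span the great circle through u and v, with v at angle t from u *)
have vE : v = cos t *: u + sin t *: w.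
  by rewrite /w scalerA divff ?gt_eqF// scale1r addrC subrK.
pose K := Num.truncn (pi *+ 2 / t).
have P0 : 0 <= pi *+ 2 / t := divr_ge0 (mulrn_wge0 2 (ltW pi0)) (ltW t0).
have /andP[K1 K2] := truncn_itv P0.
have MK : (M <= K)%N.
  rewrite truncn_ge_nat//.
  rewrite ler_pdivlMr//; move: bM; rewrite ler_pdivlMr// mulr2n.
  have : t * M%:R <= b * 2 * M%:R by rewrite ler_wpM2r//; lra.
  by lra.
have := @sph_lune_circle n u w t K uu ww uw t0.
rewrite -vE -ler_pdivlMr// => /(_ K1).
rewrite -(fineK (sph_fin (measurable_lune u v))) -!EFinM !lee_fin.
move: (fine _) => L KL.
have aK : 1 <= a * K%:R.
  rewrite -ler_pdivrMl// mulr1; apply: le_trans (ltW aM) _.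
  by rewrite ler_nat.
have K0 : 0 < K%:R :> R by rewrite (lt_le_trans M0)// ler_nat.
have L0 : L <= K%:R^-1 by rewrite -[leRHS]mulr1 ler_pdivlMl.
have h1 : pi *+ 2 * L <= (1 + a) * t.
  apply: (@le_trans _ _ (pi *+ 2 / K%:R)); first by rewrite ler_wpM2l// mulrn_wge0// ltW.
  rewrite ler_pdivrMr//; move: K2; rewrite ltr_pdivrMr// -natr1 => K2.
  have : t * 1 <= t * (a * K%:R) by rewrite ler_wpM2l.
  by lra.
have h2 : (1 - a) * (t / 2) <= sin (t / 2) by apply: sinlb; apply/andP; split; lra.
apply: (le_trans h1); rewrite dE.
have : (1 + a) * t <= ((1 + e) * (1 - a)) * t by rewrite ler_wpM2r.
have : (1 + e) * ((1 - a) * (t / 2)) <= (1 + e) * sin (t / 2) by rewrite ler_wpM2l//; lra.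
nra.
Qed.

End SphereMeasure.

(** * Differentiating the unit tangent *)

Section VectorCalculus.
Context {R : realType} {n : nat}.
Implicit Types A B v : R -> 'rV[R]_n.

Lemma is_derive_coord A t (i : 'I_n) : derivable A t 1 ->
  is_derive t (1 : R) (fun s => A s ord0 i) (A^`()%classic t ord0 i).
Proof.
move=> dA; apply: DeriveDef; first exact: (derivable_mxP _ _ _).1.
by rewrite derive1E derive_mx// mxE.
Qed.

Lemma is_derive_dot A B t : derivable A t 1 -> derivable B t 1 ->
  is_derive t (1 : R) (fun s => dot (A s) (B s))
    (dot (A^`()%classic t) (B t) + dot (A t) (B^`()%classic t)).
Proof.
move=> dA dB.
rewrite (_ : (fun s => dot (A s) (B s)) =
   \sum_(i < n) ((fun s => A s ord0 i) * (fun s => B s ord0 i))); last first.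
  by apply/funext => s; rewrite fct_sumE.
have := @is_derive_sum _ _ _ n _ t 1 _ (fun i =>
  is_deriveM (is_derive_coord i dA) (is_derive_coord i dB)).
move=> H; apply: (is_derive_eq H).
rewrite /dot -big_split; apply: eq_bigr => i _ /=.
by rewrite /GRing.scale /=; ring.
Qed.

Lemma is_derive_dotr A (x : 'rV[R]_n) t : derivable A t 1 ->
  is_derive t (1 : R) (fun s => dot x (A s)) (dot x (A^`()%classic t)).
Proof.
move=> dA; have := @is_derive_dot (cst x) A t (derivable_cst _ _ _) dA.
by rewrite derive1_cst dot0l add0r.
Qed.

Lemma continuous_dot A B t : {for t, continuous A} -> {for t, continuous B} ->
  {for t, continuous (fun s => dot (A s) (B s))}.
Proof.
move=> cA cB; apply: cvg_big => [|k _]; first exact: add_continuous.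
have cc (C : R -> 'rV[R]_n) i : {for t, continuous C} -> {for t, continuous (fun s => C s ord0 i : R)}.
  move=> cC; apply: (@continuous_comp _ _ _ C (fun M : 'rV[R]_n => M ord0 i)) => //.
  exact: coord_continuous.
by apply: cvgM; exact: cc.
Qed.

Lemma continuous_enorm A t : {for t, continuous A} ->
  {for t, continuous (fun s => enorm (A s))}.
Proof.
move=> cA; apply: (@continuous_comp _ _ _ (fun s => dot (A s) (A s)) Num.sqrt).
  exact: continuous_dot.
exact: sqrt_continuous.
Qed.

(** Formula for the derivative of the unit tangent v/|v|; the identification is
    derive_unitv.  The explicit form shows its continuity. *)
Definition dunit v t : 'rV[R]_n :=
  (enorm (v t))^-1 *: v^`()%classic t -
  (dot (v t) (v^`()%classic t) / enorm (v t) ^+ 3) *: v t.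

Lemma is_derive_enorm v t : derivable v t 1 -> v t != 0 ->
  is_derive t (1 : R) (fun s => enorm (v s)) (dot (v t) (v^`()%classic t) / enorm (v t)).
Proof.
move=> dv v0.
have d0 : 0 < dot (v t) (v t) by rewrite -sqr_enorm exprn_gt0// enorm_gt0.
have := is_derive1_comp (is_derive1_sqrt d0) (is_derive_dot dv dv).
move=> H; apply: (is_derive_eq H); rewrite -/(enorm _) (dotC (v^`()%classic t)).
by field; rewrite enorm_eq0.
Qed.

Lemma is_derive_unitv_coord v t i : derivable v t 1 -> v t != 0 ->
  is_derive t (1 : R) (fun s => unitv (v s) ord0 i) (dunit v t ord0 i).
Proof.
move=> dv v0.
rewrite (_ : (fun s => _) = (fun s => (enorm (v s))^-1) * (fun s => v s ord0 i)); last first.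
  by apply/funext => s; rewrite mxE.
have e0 : enorm (v t) != 0 by rewrite enorm_eq0.
have H1 := @is_deriveV _ (fun s => enorm (v s)) _ _ _ e0 (is_derive_enorm dv v0).
have := is_deriveM H1 (is_derive_coord i dv).
move=> H; apply: (is_derive_eq H); rewrite /dunit !mxE /GRing.scale /=.
by field.
Qed.

Lemma derivable_unitv v t : derivable v t 1 -> v t != 0 ->
  derivable (fun s => unitv (v s)) t 1.
Proof.
move=> dv v0; apply/derivable_mxP => j i; rewrite (ord1 j).
by have [] := is_derive_unitv_coord i dv v0.
Qed.

Lemma derive_unitv v t : derivable v t 1 -> v t != 0 ->
  (fun s => unitv (v s))^`()%classic t = dunit v t.
Proof.
move=> dv v0; rewrite derive1E derive_mx; last exact: derivable_unitv.
apply/rowP => i; rewrite mxE.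
by have [_ ->] := is_derive_unitv_coord i dv v0.
Qed.

Lemma continuous_dunit v t : {for t, continuous v} -> {for t, continuous v^`()%classic} ->
  v t != 0 -> {for t, continuous (dunit v)}.
Proof.
move=> cv ca v0; have e0 : enorm (v t) != 0 by rewrite enorm_eq0.
have cn := continuous_enorm cv.
apply: cvgB; apply: cvgZ => //; first exact: cvgV.
apply: cvgM; first exact: continuous_dot.
apply: cvgV; first by rewrite expf_neq0.
apply: (@continuous_comp _ _ _ (fun s => enorm (v s)) (fun x => x ^+ 3)) => //.
exact: exprn_continuous.
Qed.

End VectorCalculus.

(** * Chords of the tangent indicatrix *)

Section Arc.
Context {R : realType} {n : nat}.
Local Notation T := (measurableTypeR R).
Local Notation mu := (@lebesgue_measure R).
Variables (a b : R) (c gamma : R -> 'rV[R]_n).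
Hypotheses (ab : a < b) (gC2 : C2 gamma) (cg : {in `[a, b], c =1 gamma})
  (g0 : {in `[a, b], forall t, gamma^`()%classic t != 0}).

Local Notation v := (gamma^`()%classic).
Local Notation tau := (fun s => unitv (v s)).
Local Notation kappa := (fun s => enorm (dunit v s)).

Lemma velocity_derivable t : derivable v t 1.
Proof. by case: gC2. Qed.

Lemma velocity_continuous t : {for t, continuous v}.
Proof.
apply: differentiable_continuous; apply/derivable1_diffP.
exact: velocity_derivable.
Qed.

Lemma dunit_continuous t : t \in `[a, b] -> {for t, continuous (dunit v)}.
Proof.
move=> tab; apply: continuous_dunit; [exact: velocity_continuous| |exact: g0].
by case: gC2 => _ _; exact.
Qed.

Lemma kappa_continuous : {within `[a, b], continuous kappa}.
Proof.
apply: continuous_in_subspaceT => t /set_mem tab.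
by apply: continuous_enorm; exact: dunit_continuous.
Qed.

Lemma subsegment s t : s \in `[a, b] -> t \in `[a, b] -> `[s, t] `<=` `[a, b].
Proof.
rewrite !in_itv /= => /andP[as_ _] /andP[_ tb] u /=; rewrite !in_itv /= => /andP[su ut].
by rewrite (le_trans as_)// (le_trans ut).
Qed.

Lemma kappa_integrable s t : s \in `[a, b] -> t \in `[a, b] ->
  mu.-integrable `[s, t] (EFin \o kappa).
Proof.
move=> sab tab; apply: continuous_compact_integrable; first exact: segment_compact.
by apply: continuous_subspaceW kappa_continuous; exact: subsegment.
Qed.

Lemma is_derive_dot_tau w t : t \in `[a, b] ->
  is_derive t (1 : R) (fun s => dot w (tau s)) (dot w (dunit v t)).
Proof.
move=> tab; rewrite -derive_unitv; [|exact: velocity_derivable|exact: g0].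
apply: is_derive_dotr; apply: derivable_unitv; [exact: velocity_derivable|exact: g0].
Qed.

Lemma tau_derivable w t : t \in `[a, b] -> derivable (fun s => dot w (tau s)) t 1.
Proof. by move=> /(is_derive_dot_tau w) []. Qed.

Lemma dot_unitv_self (z : 'rV[R]_n) : z != 0 -> dot (unitv z) z = enorm z.
Proof.
move=> z0; rewrite /unitv dotZl -sqr_enorm expr2 mulrA mulVf ?mul1r//.
by rewrite enorm_eq0.
Qed.

(** Apply the fundamental theorem of calculus to the component of the unit tangent
    in the direction w of the chord, whose derivative is at most |dT|. *)
Lemma chord_le_integral s t : s \in `[a, b] -> t \in `[a, b] -> s < t ->
  enorm (tau t - tau s) <= \int[mu]_(u in `[s, t]) kappa u.
Proof.
move=> sab tab st; have [->|z0] := eqVneq (tau t - tau s) 0.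
  rewrite {1}/enorm dot0l sqrtr0; apply: Rintegral_ge0 => u _; exact: enorm_ge0.
set z := tau t - tau s in z0 *; have zE : tau t - tau s = z by [].
clearbody z; pose w := unitv z.
have ww : dot w w = 1 by exact: unitv_dot.
have sub := subsegment sab tab.
have cw : {within `[s, t], continuous (fun u => dot w (dunit v u))}.
  apply: continuous_in_subspaceT => u /set_mem /sub uab.
  by apply: continuous_dot; [exact: cvg_cst|exact: dunit_continuous].
have -> : enorm z = \int[mu]_(u in `[s, t]) dot w (dunit v u).
  rewrite /Rintegral (continuous_FTC2 (F := fun u => dot w (tau u)) st cw).
  - by rewrite -EFinB /= -dotBr zE dot_unitv_self.
  - have cc u : u \in `[a, b] -> {for u, continuous (fun s => dot w (tau s))}.
      move=> uab; apply: differentiable_continuous; apply/derivable1_diffP.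
      exact: tau_derivable.
    split.
    + move=> u ust; apply: tau_derivable; apply: sub; exact: subset_itv_oo_cc ust.
    + by apply: cvg_at_right_filter; exact: cc.
    + by apply: cvg_at_left_filter; exact: cc.
  - move=> u ust; rewrite derive1E.
    have uab : u \in `[a, b] by apply: sub; exact: subset_itv_oo_cc ust.
    by have [_ ->] := is_derive_dot_tau w uab.
apply: le_Rintegral => //.
- by apply: continuous_compact_integrable => //; exact: segment_compact.
- exact: kappa_integrable.
- by move=> u _; exact: dot_le_enorm.
Qed.

Lemma chord_lipschitz : exists2 M, 0 < M & forall s t,
  s \in `[a, b] -> t \in `[a, b] -> s < t -> enorm (tau t - tau s) <= M * (t - s).
Proof.
have [m mab kM] := EVT_max (ltW ab) kappa_continuous.
exists (kappa m + 1); first by rewrite ltr_wpDl// enorm_ge0.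
move=> s t sab tab st; have [->|z0] := eqVneq (tau t - tau s) 0.
  rewrite {1}/enorm dot0l sqrtr0 mulr_ge0// ?subr_ge0 ?(ltW st)//.
  by rewrite addr_ge0// enorm_ge0.
set z := tau t - tau s in z0 *; have zE : tau t - tau s = z by [].
clearbody z; pose w := unitv z.
have ww : dot w w = 1 by exact: unitv_dot.
have sub := subsegment sab tab.
have [u ust] : exists2 u, u \in `]s, t[ &
    dot w (tau t) - dot w (tau s) = dot w (dunit v u) * (t - s).
  apply: (@MVT _ (fun u => dot w (tau u)) (fun u => dot w (dunit v u))) => //.
    by move=> u ust; apply: is_derive_dot_tau; apply: sub; exact: subset_itv_oo_cc ust.
  by apply: derivable_within_continuous => u ust; apply: tau_derivable; exact: sub.
rewrite -dotBr zE (dot_unitv_self z0) => ->.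
rewrite ler_wpM2r ?subr_ge0 ?(ltW st)//.
apply: le_trans (dot_le_enorm _ ww) _; apply: le_trans (kM _ _) _.
  by apply: sub; exact: subset_itv_oo_cc ust.
by rewrite lerDl.
Qed.

(** Inside the arc the curve agrees with its regular extension near every point,
    so |k| ds is |dT/dt| dt; the endpoints do not matter to the integral. *)
Lemma total_curvatureE : total_curvature c a b =
  (\int[mu]_(t in `[a, b]) kappa t)%:E.
Proof.
have aab : a \in `[a, b] by rewrite in_itv /= lexx ltW.
have bab : b \in `[a, b] by rewrite in_itv /= lexx ltW.
have mk : measurable_fun `[a, b] (EFin \o kappa).
  by have /integrableP[] := kappa_integrable aab bab.
have mk1 : measurable_fun `]a, b[ (EFin \o kappa).
  by apply: measurable_funS mk => //; exact: subset_itv_oo_cc.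
have mk2 : measurable_fun `[a, b[ (EFin \o kappa).
  by apply: measurable_funS mk => //; exact: subset_itv_co_cc.
rewrite /Rintegral fineK; last first.
  by apply: integrable_fin_num => //; exact: kappa_integrable.
rewrite -integral_itv_bndo_bndc// -integral_itv_obnd_cbnd//.
rewrite /total_curvature; apply: eq_integral => t /set_mem tab; congr EFin.
have tab' := subset_itv_oo_cc tab.
have nc : \near t, c t = gamma t.
  near=> u; apply: cg; apply: subset_itv_oo_cc.
  by near: u; apply: near_in_itvoo.
have dcg : \near t, c^`()%classic t = v t.
  move/near_join : nc; apply: filterS => u nu.
  by rewrite !derive1E; exact: near_eq_derive.
have st : speed c t = enorm (v t).
  by rewrite /speed (nbhs_singleton dcg).
have e0 : enorm (v t) != 0 by rewrite enorm_eq0; exact: g0.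
rewrite /curvature_vector st.
have -> : (fun u => unitv (c^`()%classic u))^`()%classic t = dunit v t.
  rewrite -derive_unitv; [|exact: velocity_derivable|exact: g0].
  rewrite !derive1E; apply: near_eq_derive.
  by move: dcg; apply: filterS => u /= ->.
rewrite (enormZ _ (_ : 0 <= (enorm (v t))^-1)); last by rewrite invr_ge0 enorm_ge0.
by rewrite mulrAC mulVf ?mul1r.
Unshelve. all: by end_near. Qed.

End Arc.

(** * Directions with an interior maximum on an arc *)

Section ArcDirections.
Context {R : realType} {n : nat}.
Local Notation T := (measurableTypeR R).
Local Notation mu := (@lebesgue_measure R).
Variables (a b : R) (c gamma : R -> 'rV[R]_n).
Hypotheses (ab : a < b) (gC2 : C2 gamma) (cg : {in `[a, b], c =1 gamma})
  (g0 : {in `[a, b], forall t, gamma^`()%classic t != 0}).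

Local Notation v := (gamma^`()%classic).
Local Notation tau := (fun s => unitv (v s)).
Local Notation kappa := (fun s => enorm (dunit v s)).

Definition dyadic (N i : nat) : R := a + (b - a) * i%:R / (2 ^ N)%:R.

Let pow2_gt0 N : 0 < (2 ^ N)%:R :> R.
Proof. by rewrite ltr0n expn_gt0. Qed.

Let dyadic_in N i : (i <= 2 ^ N)%N -> dyadic N i \in `[a, b].
Proof.
move=> iN; rewrite in_itv /= /dyadic lerDl; apply/andP; split.
  by rewrite divr_ge0// ?mulr_ge0// ?subr_ge0 ?ltW.
rewrite -lerBrDl ler_pdivrMr// ler_wpM2l ?ler_nat// subr_ge0 ltW//.
Qed.

Let dyadicS N i : dyadic N i.+1 - dyadic N i = (b - a) / (2 ^ N)%:R.
Proof.
rewrite /dyadic opprD addrACA subrr add0r -mulrBl -mulrBr -natrB// subSnn mulr1.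
by [].
Qed.

Let dyadic_lt N i : dyadic N i < dyadic N i.+1.
Proof. by rewrite -subr_gt0 dyadicS divr_gt0// subr_gt0. Qed.

Let sum_chords N k : (k <= 2 ^ N)%N ->
  \sum_(i < k) enorm (tau (dyadic N i.+1) - tau (dyadic N i)) <=
  \int[mu]_(u in `[a, dyadic N k]) kappa u.
Proof.
elim: k => [_|k IH kN].
  by rewrite big_ord0; apply: Rintegral_ge0 => u _; exact: enorm_ge0.
have kN' := ltnW kN.
have aab : a \in `[a, b] by rewrite in_itv /= lexx ltW.
rewrite big_ord_recr /=.
apply: le_trans (lerD (IH kN') (chord_le_integral gC2 g0 (dyadic_in kN')
  (dyadic_in kN) (dyadic_lt N k))) _.
have := @Rintegral_itvB R kappa (BLeft a) (BRight (dyadic N k.+1)) (dyadic N k)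
  (kappa_integrable gC2 g0 aab (dyadic_in kN)).
have ak : a <= dyadic N k by have := dyadic_in kN'; rewrite in_itv /= => /andP[].
rewrite !bnd_simp ak (ltW (dyadic_lt N k)) => /(_ isT isT).
rewrite Rintegral_itv_obnd_cbnd; last first.
  apply: integrableS (kappa_integrable gC2 g0 (dyadic_in kN') (dyadic_in kN)) => //.
  exact: subset_itv_oc_cc.
by move=> <-; rewrite addrC subrK.
Qed.

(** Seen from these directions the height first rises at one point of the N-th
    subdivision and then falls at a later one.  Comparing any two points, rather than
    consecutive ones, makes the sets increase with N. *)
Definition turning_at N : set (n.-tuple T) :=
  \bigcup_(p in [set p : 'I_(2 ^ N).+1 * 'I_(2 ^ N).+1 | (p.1 < p.2)%N])
    lune (tau (dyadic N p.1)) (tau (dyadic N p.2)).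

Let measurable_turning_at N : measurable (turning_at N).
Proof.
by apply: fin_bigcup_measurable => // p _; exact: measurable_lune.
Qed.

Let turning_nd : {homo turning_at : N M / (N <= M)%N >-> (N <= M)%O}.
Proof.
apply: homo_leq => [X|Y X Z|N]; [exact: lexx|exact: le_trans|].
apply/subsetPset => x [[i j] /= ij [xi xj]].
have h (k : 'I_(2 ^ N).+1) : (k.*2 < (2 ^ N.+1).+1)%N.
  by rewrite ltnS expnS mul2n leq_double -ltnS.
exists (Ordinal (h i), Ordinal (h j)) => /=; first by rewrite ltn_double.
have dE k : dyadic N.+1 k.*2 = dyadic N k.
  rewrite /dyadic expnS natrM -mul2n natrM; congr (a + _).
  by field; rewrite gt_eqF.
by rewrite !dE.
Qed.

(** Between a rising and a later falling subdivision point there are two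
    consecutive ones where the sign changes, so x lies in one of the lunes spanned by
    consecutive tangents, unless it is orthogonal to a tangent. *)
Let turning_bound (e : R) : 0 < e -> exists N0, forall N, (N0 <= N)%N ->
  ((pi *+ 2)%:E * sph (turning_at N) <=
   ((1 + e) * \int[mu]_(u in `[a, b]) kappa u)%:E)%E.
Proof.
move=> e0; have [d d0 dP] := sph_lune_chord e0.
have [M M0 lip] := chord_lipschitz ab gC2 g0.
pose N0 := (Num.truncn (M * (b - a) / d)).+1.
exists N0 => N NN0.
pose chord i := enorm (tau (dyadic N i.+1) - tau (dyadic N i)).
(* the hyperplanes absorb sign changes that pass through 0 *)
pose B i := lune (tau (dyadic N i)) (tau (dyadic N i.+1)) `|`
  [set x : n.-tuple T | dot (row_of_tuple x) (tau (dyadic N i)) = 0].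
have t0 i : (i <= 2 ^ N)%N -> tau (dyadic N i) != 0.
  move=> iN; rewrite -dot_eq0 unitv_dot ?oner_eq0//.
  by apply: g0; exact: dyadic_in.
have mZ i : measurable [set x : n.-tuple T | dot (row_of_tuple x) (tau (dyadic N i)) = 0].
  exact: (measurable_preim (measurable_dot _) (measurable_set1 0)).
have mB i : measurable (B i) by apply: measurableU => //; exact: measurable_lune.
have sB i : (i < 2 ^ N)%N -> (sph (B i) <=
    sph (lune (tau (dyadic N i)) (tau (dyadic N i.+1))))%E.
  move=> iN; rewrite measureU0//; first exact: measurable_lune.
  by apply: sph_hyperplane; apply: t0; exact: ltnW.
have sub : turning_at N `<=` \big[setU/set0]_(i < 2 ^ N) B i.
  move=> x [[[i iN] [j jN]] /= ij [xi xj]].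
  rewrite -(bigcup_mkord (2 ^ N) B).
  elim: j jN ij xj => // j IH jN; rewrite ltnS leq_eqVlt => /predU1P[ij|ij] xj.
    by rewrite ij in xi; exists j => //=; left; exact: (conj xi xj).
  have [xj0|xj0|xj0] := ltgtP (dot (row_of_tuple x) (tau (dyadic N j))) 0.
  - by apply: (IH (ltnW jN)).
  - by exists j => //=; left.
  - by exists j => //=; right.
have pi20 : (0 <= (pi *+ 2)%:E :> \bar R)%E.
  by rewrite lee_fin mulrn_wge0// ltW// pi_gt0.
apply: (@le_trans _ _ ((pi *+ 2)%:E * \sum_(i < 2 ^ N) sph (B i))%E).
  rewrite lee_wpmul2l//; apply: content_subadditive => //.
rewrite ge0_sume_distrr; last by move=> i _; exact: measure_ge0.
apply: (@le_trans _ _ (\sum_(i < 2 ^ N) ((1 + e) * chord i)%:E)%E).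
  apply: lee_sum => i _.
  apply: (@le_trans _ _ ((pi *+ 2)%:E * sph (lune (tau (dyadic N i)) (tau (dyadic N i.+1))))%E).
    by rewrite lee_wpmul2l// sB.
  have iN : (i <= 2 ^ N)%N by exact: ltnW.
  have -> : chord i = enorm (tau (dyadic N i) - tau (dyadic N i.+1)).
    exact: enormB.
  apply: dP.
  - by apply: unitv_dot; apply: g0; exact: dyadic_in.
  - by apply: unitv_dot; apply: g0; exact: dyadic_in.
  - rewrite enormB.
    apply: le_lt_trans (lip _ _ (dyadic_in iN) (dyadic_in (ltn_ord i)) (dyadic_lt N i)) _.
    rewrite dyadicS mulrA ltr_pdivrMr// [ltRHS]mulrC -ltr_pdivrMr//.
    apply: lt_le_trans (truncnS_gt _) _; rewrite ler_nat.
    by apply: leq_trans NN0 _; exact: ltnW (ltn_expl _ _).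
rewrite sumEFin lee_fin -mulr_sumr ler_wpM2l ?addr_ge0// ?(ltW e0)//.
have := sum_chords (leqnn (2 ^ N)).
have -> : dyadic N (2 ^ N) = b by rewrite /dyadic mulfK ?gt_eqF// addrC subrK.
by [].
Qed.

Definition turning : set (n.-tuple T) := \bigcup_N turning_at N.

Lemma measurable_turning : measurable turning.
Proof. by apply: bigcupT_measurable. Qed.

(** One-sided Crofton inequality: continuity from below lets N tend to infinity,
    and then the relative error e of the lune estimate tends to 0. *)
Lemma turning_le : ((pi *+ 2)%:E * sph turning <= total_curvature c a b)%E.
Proof.
rewrite (total_curvatureE ab gC2 cg g0).
set I := \int[mu]_(u in _) _.
have I0 : 0 <= I by apply: Rintegral_ge0 => u _; exact: enorm_ge0.
have pi0 : 0 < pi *+ 2 :> R by rewrite pmulrn_lgt0// pi_gt0.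
have cvgW := nondecreasing_cvg_mu (mu := @sph R n) measurable_turning_at
  measurable_turning turning_nd.
rewrite -(fineK (sph_fin measurable_turning)) -EFinM lee_fin.
apply/ler_addgt0Pr => e e0.
have e'0 : 0 < e / (I + 1) by rewrite divr_gt0// ltr_wpDl.
have [N0 HN] := turning_bound e'0.
have bound : (sph turning <= ((pi *+ 2)^-1 * ((1 + e / (I + 1)) * I))%:E)%E.
  rewrite -(cvg_lim _ cvgW)//; apply: lime_le; first by apply/cvg_ex; exists (sph turning).
  exists N0 => // N /= NN0; move: (HN N NN0).
  rewrite -(fineK (sph_fin (measurable_turning_at N))) -EFinM !lee_fin.
  by rewrite ler_pdivlMl.
move: bound; rewrite -(fineK (sph_fin measurable_turning)) lee_fin ler_pdivlMl//.
move/le_trans; apply; rewrite mulrDl mul1r lerD2l.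
by rewrite mulrAC ler_pdivrMr ?ltr_wpDl// mulrDr mulr1 lerDl ltW.
Qed.

(** Strict inequalities between continuous functions persist near s and t, where
    fine subdivisions have points. *)
Lemma turningP x s t : s \in `[a, b] -> t \in `[a, b] -> s < t ->
  0 < dot (row_of_tuple x) (v s) -> dot (row_of_tuple x) (v t) < 0 -> turning x.
Proof.
move=> sab tab st xs xt; set r := row_of_tuple x.
have cF u : {for u, continuous (fun u => dot r (v u))}.
  by apply: continuous_dot; [exact: cvg_cst|exact: velocity_continuous].
have /nbhs_ballP[d1 /= d10 H1] : \forall u \near s, 0 < dot r (v u).
  by apply: (cvgr_gt _ (cF s)).
have /nbhs_ballP[d2 /= d20 H2] : \forall u \near t, dot r (v u) < 0.
  by apply: (cvgr_lt _ (cF t)).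
pose d := Num.min (Num.min d1 d2) (t - s).
have d0 : 0 < d by rewrite !lt_min d10 d20 subr_gt0.
pose N := (Num.truncn ((b - a) / d)).+1.
have hN : (b - a) / (2 ^ N)%:R < d.
  rewrite ltr_pdivrMr// mulrC -ltr_pdivrMr//.
  apply: lt_le_trans (truncnS_gt _) _; rewrite ler_nat.
  exact: ltnW (ltn_expl _ _).
pose idx u := Num.truncn ((u - a) * (2 ^ N)%:R / (b - a)).
have ba0 : 0 < b - a by rewrite subr_gt0.
have idxP u : u \in `[a, b] -> [/\ (idx u <= 2 ^ N)%N, dyadic N (idx u) <= u
    & u - d < dyadic N (idx u)].
  rewrite in_itv /= => /andP[au ub].
  have p0 : 0 <= (u - a) * (2 ^ N)%:R / (b - a).
    by rewrite divr_ge0 ?mulr_ge0 ?subr_ge0// ltW.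
  have /andP[k1 k2] := truncn_itv p0.
  split.
  - rewrite -(ler_nat R); apply: le_trans k1 _.
    by rewrite ler_pdivrMr// mulrC ler_wpM2l// lerD2r.
  - rewrite /dyadic -lerBrDl ler_pdivrMr// mulrC -ler_pdivlMr//.
  - rewrite ltrBlDr -ltrBlDl; apply: le_lt_trans hN.
    move: k2; rewrite -/(idx u) ltr_pdivrMr// -natr1 => k2.
    rewrite /dyadic opprD addrA ler_pdivlMr// mulrBl divfK ?gt_eqF//.
    by lra.
have [i1 i2 i3] := idxP s sab; have [j1 j2 j3] := idxP t tab.
have ds : d <= d1 by rewrite !ge_min lexx.
have dt : d <= d2 by rewrite !ge_min lexx orbT.
have dst : d <= t - s by rewrite !ge_min lexx !orbT.
have ij : (idx s < idx t)%N.
  rewrite ltnNge; apply/negP => ji.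
  have : dyadic N (idx t) <= dyadic N (idx s).
    by rewrite /dyadic lerD2l ler_wpM2r ?invr_ge0// ler_wpM2l ?ler_nat// ltW.
  by lra.
have i1' : (idx s < (2 ^ N).+1)%N by [].
have j1' : (idx t < (2 ^ N).+1)%N by [].
exists N => //; exists (Ordinal i1', Ordinal j1') => //=; split.
  rewrite dot_unitv_gt0; last by apply: g0; exact: dyadic_in.
  apply: H1; rewrite /ball /= ger0_norm ?subr_ge0// (lt_le_trans _ ds)//.
  by rewrite ltrBlDr addrC -ltrBlDr.
rewrite dot_unitv_lt0; last by apply: g0; exact: dyadic_in.
apply: H2; rewrite /ball /= ger0_norm ?subr_ge0// (lt_le_trans _ dt)//.
by rewrite ltrBlDr addrC -ltrBlDr.
Qed.

End ArcDirections.

Section Tangents.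
Context {R : realType} {n : nat}.
Local Notation T := (measurableTypeR R).
Variables (a b : R) (c gamma : R -> 'rV[R]_n).
Hypotheses (ab : a < b) (cg : {in `[a, b], c =1 gamma}).

(** Only the values of c on the arc enter the one-sided limit, so it is the
    velocity of the regular extension. *)
Lemma tangent_afterE : derivable gamma a 1 ->
  tangent_after c a = unitv (gamma^`()%classic a).
Proof.
move=> dg; rewrite /tangent_after.
suff L : h^-1 *: (c (a + h) - c a) @[h --> (0 : R)^'+] --> gamma^`()%classic a.
  by rewrite (cvg_lim (@norm_hausdorff _ _) L).
have /cvgrPdist_le H : h^-1 *: (gamma (h *: (1 : R) + a) - gamma a)
    @[h --> (0 : R)^'] --> gamma^`()%classic a by rewrite derive1E; exact: dg.
apply/cvgrPdist_le => e e0.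
have [d /= d0 Hd] := H e e0.
near=> h.
have h0 : 0 < h by near: h; exact: nbhs_right_gt.
have hb : h < b - a by near: h; apply: nbhs_right_lt; rewrite subr_gt0.
have hd : h < d by near: h; exact: nbhs_right_lt.
have := Hd h; rewrite /ball_ /= sub0r normrN gtr0_norm// => /(_ hd).
rewrite gt_eqF// => /(_ isT).
rewrite cg ?in_itv /= ?cg ?in_itv /= ?lexx ?(ltW ab)//; last first.
  by apply/andP; split; lra.
by rewrite /GRing.scale /= mulr1 (addrC h a).
Unshelve. all: by end_near. Qed.

Lemma tangent_beforeE : derivable gamma b 1 ->
  tangent_before c b = - unitv (gamma^`()%classic b).
Proof.
move=> dg; rewrite /tangent_before -[RHS]scalerN.
rewrite (_ : (enorm _)^-1 = (enorm (- gamma^`()%classic b))^-1); last first.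
  by rewrite /enorm dotNl dotNr opprK.
rewrite -/(unitv (- gamma^`()%classic b)).
suff L : h^-1 *: (c (b - h) - c b) @[h --> (0 : R)^'+] --> - gamma^`()%classic b.
  by rewrite (cvg_lim (@norm_hausdorff _ _) L).
have /cvgrPdist_le H : h^-1 *: (gamma (h *: (1 : R) + b) - gamma b)
    @[h --> (0 : R)^'] --> gamma^`()%classic b by rewrite derive1E; exact: dg.
apply/cvgrPdist_le => e e0.
have [d /= d0 Hd] := H e e0.
near=> h.
have h0 : 0 < h by near: h; exact: nbhs_right_gt.
have hb : h < b - a by near: h; apply: nbhs_right_lt; rewrite subr_gt0.
have hd : h < d by near: h; exact: nbhs_right_lt.
have := Hd (- h); rewrite /ball_ /= sub0r opprK gtr0_norm// => /(_ hd).
rewrite oppr_eq0 gt_eqF// => /(_ isT).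
rewrite cg ?in_itv /= ?cg ?in_itv /= ?lexx ?(ltW ab)//; last first.
  by apply/andP; split; lra.
rewrite /GRing.scale /= mulr1 (addrC (- h) b) -/(GRing.scale _ _).
set X := gamma (b - h) - gamma b => Hh.
have -> : - gamma^`()%classic b - h^-1 *: X =
    - (gamma^`()%classic b - (- h)^-1 *: X).
  by rewrite invrN scaleNr opprK opprD.
by rewrite normrN.
Unshelve. all: by end_near. Qed.

End Tangents.

Section ArcDirectionsTheorem.
Context {R : realType} {n : nat}.
Local Notation T := (measurableTypeR R).

Lemma height_MVT (gamma : R -> 'rV[R]_n) (x : 'rV[R]_n) s t : C2 gamma -> s < t ->
  exists2 u, u \in `]s, t[ &
    dot x (gamma t) - dot x (gamma s) = dot x (gamma^`()%classic u) * (t - s).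
Proof.
move=> [dg _ _] st.
apply: (@MVT _ (fun u => dot x (gamma u)) (fun u => dot x (gamma^`()%classic u))) => //.
  by move=> u _; exact: is_derive_dotr.
apply: derivable_within_continuous => u _.
by have [] := is_derive_dotr x (dg u).
Qed.

(** The derivative stays positive on a short initial segment; use the mean value
    theorem there and on the remaining part. *)
Lemma height_rises (h h' : R -> R) (a b : R) : a < b ->
  (forall s t, s < t -> exists2 u, u \in `]s, t[ & h t - h s = h' u * (t - s)) ->
  {for a, continuous h'} -> 0 < h' a ->
  (forall u, u \in `]a, b[ -> 0 <= h' u) -> h a < h b.
Proof.
move=> ab mvt ca ha hge.
have /nbhs_ballP[d /= d0 H] : \forall u \near a, 0 < h' u by apply: (cvgr_gt _ ca).
pose m := Num.min (d / 2) ((b - a) / 2).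
have m0 : 0 < m by rewrite lt_min !divr_gt0// subr_gt0.
have md : m <= d / 2 by rewrite ge_min lexx.
have mb : m <= (b - a) / 2 by rewrite ge_min lexx orbT.
clearbody m.
have am : a < a + m by lra.
have bm : a + m < b by lra.
have [u1 /itvP u1i e1] := mvt _ _ am.
have [u2 /itvP u2i e2] := mvt _ _ bm.
have h1 : 0 < h' u1.
  by apply: H; rewrite /ball /= ltr_norml; apply/andP; split;
    [have : u1 < a + m by rewrite u1i|have : a < u1 by rewrite u1i]; lra.
have h2 : 0 <= h' u2.
  apply: hge; rewrite in_itv /= (lt_trans am) ?u2i//.
have : 0 < h' u1 * (a + m - a) by rewrite mulr_gt0// subr_gt0.
have : 0 <= h' u2 * (b - (a + m)) by rewrite mulr_ge0// subr_ge0 ltW.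
lra.
Qed.

Lemma height_falls (h h' : R -> R) (a b : R) : a < b ->
  (forall s t, s < t -> exists2 u, u \in `]s, t[ & h t - h s = h' u * (t - s)) ->
  {for b, continuous h'} -> h' b < 0 ->
  (forall u, u \in `]a, b[ -> h' u <= 0) -> h b < h a.
Proof.
move=> ab mvt cb hb hle.
have /nbhs_ballP[d /= d0 H] : \forall u \near b, h' u < 0 by apply: (cvgr_lt _ cb).
pose m := Num.min (d / 2) ((b - a) / 2).
have m0 : 0 < m by rewrite lt_min !divr_gt0// subr_gt0.
have md : m <= d / 2 by rewrite ge_min lexx.
have mb : m <= (b - a) / 2 by rewrite ge_min lexx orbT.
clearbody m.
have am : a < b - m by lra.
have bm : b - m < b by lra.
have [u1 /itvP u1i e1] := mvt _ _ am.
have [u2 /itvP u2i e2] := mvt _ _ bm.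
have h2 : h' u2 < 0.
  by apply: H; rewrite /ball /= ltr_norml; apply/andP; split;
    [have : u2 < b by rewrite u2i|have : b - m < u2 by rewrite u2i]; lra.
have h1 : h' u1 <= 0.
  by apply: hle; rewrite in_itv /= u1i (lt_trans _ bm) ?u1i.
have : h' u1 * (b - m - a) <= 0 by rewrite mulr_le0_ge0// subr_ge0 ltW.
have : h' u2 * (b - (b - m)) < 0 by rewrite nmulr_rlt0// subr_gt0.
lra.
Qed.

(** What the lower bound uses about an arc.  Outside W the height never falls after
    having risen, so if it starts upwards it keeps rising to the end; read backwards,
    if it is higher just before the end than at the end, it fell all the way. *)
Lemma arc_directions (a b : R) (c : R -> 'rV[R]_n) :
  a < b -> regular_C2_arc a b c -> exists W : set (n.-tuple T),
  [/\ measurable W, ((pi *+ 2)%:E * sph W <= total_curvature c a b)%E,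
    tangent_after c a != 0, tangent_before c b != 0 &
    forall x, ~ W x -> let h t := dot (row_of_tuple x) (c t) in
    (0 < dot (row_of_tuple x) (tangent_after c a) ->
      h a < h b /\ dot (row_of_tuple x) (tangent_before c b) <= 0) /\
    (0 < dot (row_of_tuple x) (tangent_before c b) ->
      h b < h a /\ dot (row_of_tuple x) (tangent_after c a) <= 0)].
Proof.
move=> ab [gamma [gC2 cg g0]].
have aab : a \in `[a, b] by rewrite in_itv /= lexx ltW.
have bab : b \in `[a, b] by rewrite in_itv /= lexx ltW.
have dg t : derivable gamma t 1 by case: gC2.
exists (turning a b gamma).
rewrite (tangent_afterE ab cg)// (tangent_beforeE ab cg)//.
have u0 (z : 'rV[R]_n) : z != 0 -> unitv z != 0.
  by move=> z0; rewrite -dot_eq0 unitv_dot// oner_eq0.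
split.
- exact: measurable_turning.
- exact: turning_le.
- by apply: u0; exact: g0.
- by rewrite oppr_eq0; apply: u0; exact: g0.
move=> x Wx; set r := row_of_tuple x; rewrite /= !(cg a aab) !(cg b bab).
rewrite dotNr oppr_gt0 oppr_le0 !(dot_unitv_gt0 _ (g0 _ aab)) (dot_unitv_lt0 _ (g0 _ bab)).
rewrite !leNgt (dot_unitv_lt0 _ (g0 _ bab)) (dot_unitv_gt0 _ (g0 _ aab)).
have cF u : {for u, continuous (fun u => dot r (gamma^`()%classic u))}.
  by apply: continuous_dot; [exact: cvg_cst|exact: velocity_continuous].
have noturn s t : s \in `[a, b] -> t \in `[a, b] -> s < t ->
    0 < dot r (gamma^`()%classic s) -> 0 <= dot r (gamma^`()%classic t).
  move=> sab tab st rs; rewrite leNgt; apply/negP => rt; apply: Wx.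
  exact: turningP sab tab st rs rt.
have mvt s t : s < t -> exists2 u, u \in `]s, t[ &
    dot r (gamma t) - dot r (gamma s) = dot r (gamma^`()%classic u) * (t - s).
  by move=> st; exact: height_MVT.
have inab u : u \in `]a, b[ -> [/\ u \in `[a, b], a < u & u < b].
  by move=> uab; split; [exact: subset_itv_oo_cc|rewrite (itvP uab)..].
split=> [ra|rb]; split.
- apply: (height_rises ab mvt (cF a) ra) => u /inab[uab au _].
  exact: noturn ra.
- by rewrite -leNgt; exact: noturn ra.
- apply: (height_falls ab mvt (cF b) rb) => u /inab[uab _ ub].
  rewrite leNgt; apply/negP => /(noturn _ _ uab bab ub).
  by rewrite leNgt rb.
- by apply/negP => /(noturn _ _ aab bab ab); rewrite leNgt rb.
Qed.

End ArcDirectionsTheorem.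

(** * Orientations of the complete graph *)

Section Tournament.
Context {R : realFieldType} {m : nat}.
Local Notation E := (edge (complete_graph m)).
Local Notation src e := (@src (complete_graph m) e : 'I_m).
Local Notation tgt e := (@tgt (complete_graph m) e : 'I_m).

(** Total of the signs of the edge ends at q: [alpha] is the sign of an edge at
    its source, [beta] at its target. *)
Definition incidence_sum (alpha beta : E -> R) (q : 'I_m) : R :=
  \sum_(e : E | src e == q) alpha e + \sum_(e : E | tgt e == q) beta e.

(** Score of the transitive tournament: a vertex above k others and below the
    remaining m - 1 - k has k - (m - 1 - k) as sum of signs. *)
Definition total_score : R := \sum_(k < m) Num.max (k%:R *+ 2 - m.-1%:R) 0.

Lemma incidence_sum_pairs (F : 'I_m -> 'I_m -> R) q :
  incidence_sum (fun e => F (src e) (tgt e)) (fun e => F (tgt e) (src e)) q =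
  \sum_(p | p != q) F q p.
Proof.
pose A := [pred p : 'I_m * 'I_m | (p.1 < p.2)%N].
rewrite /incidence_sum.
rewrite -(big_sub_cond A (fun p => p.1 == q) (fun p => F p.1 p.2)).
rewrite -(big_sub_cond A (fun p => p.2 == q) (fun p => F p.2 p.1)) /=.
have -> : \sum_(p in A | p.1 == q) F p.1 p.2 = \sum_(j : 'I_m | (q < j)%N) F q j.
  rewrite (eq_bigl (fun p : 'I_m * 'I_m => (p.1 == q) && (p.1 < p.2)%N)); last first.
    by move=> p; rewrite inE andbC.
  rewrite -(pair_big_dep (fun i => i == q) (fun i j : 'I_m => (i < j)%N) F) /=.
  by rewrite big_pred1_eq.
have -> : \sum_(p in A | p.2 == q) F p.2 p.1 = \sum_(j : 'I_m | (j < q)%N) F q j.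
  rewrite (eq_bigl (fun p : 'I_m * 'I_m => true && ((p.1 < p.2)%N && (p.2 == q)))); last first.
    by move=> p; rewrite inE.
  rewrite -(pair_big_dep xpredT (fun i j : 'I_m => (i < j)%N && (j == q))
    (fun i j => F j i)) /= [RHS]big_mkcond.
  by apply: eq_bigr => i _; rewrite big_mkcondl big_pred1_eq.
rewrite [RHS](bigID (fun p : 'I_m => (q < p)%N)) /=; congr (_ + _).
  by apply: eq_bigl => p; rewrite -(inj_eq val_inj) /= neq_ltn; case: ltngtP.
by apply: eq_bigl => p; rewrite -(inj_eq val_inj) /= neq_ltn -leqNgt; case: ltngtP.
Qed.

Variable lo : rel 'I_m.
Hypotheses (lo_irr : irreflexive lo) (lo_trans : transitive lo)
  (lo_total : forall p q, p != q -> lo p q || lo q p).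

(** The sign at p of an edge from p to q along which the height is monotone. *)
Definition local_sign (p q : 'I_m) : R := if lo q p then 1 else -1.

(** The number of lower vertices is a bijection onto 0, ..., m - 1. *)
Lemma tournament_score :
  \sum_q Num.max (incidence_sum (fun e => local_sign (src e) (tgt e))
    (fun e => local_sign (tgt e) (src e)) q) 0 = total_score.
Proof.
pose rank q := #|[pred p | lo p q]|.
have rank_lt q : (rank q < m)%N.
  have : [pred p | lo p q] \proper 'I_m.
    apply/properP; split; first by apply/fintype.subsetP.
    by exists q; rewrite ?inE// lo_irr.
  by move/proper_card; rewrite card_ord.
have rankE q : \sum_(p | p != q) local_sign q p = (rank q)%:R *+ 2 - m.-1%:R.
  rewrite (eq_bigr (fun p => (lo p q)%:R *+ 2 - 1)); last first.
    by move=> p _; rewrite /local_sign; case: lo; rewrite ?mulr2n/=; ring.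
  rewrite big_split /= sumrN sumr_const cardC1 card_ord; congr (_ - _).
  rewrite sumrMnl; congr (_ *+ 2).
  rewrite /rank -sum1_card natr_sum [LHS]big_mkcond [RHS]big_mkcond /=.
  by apply: eq_bigr => p _; rewrite inE; case: eqVneq => [->|_]; rewrite ?lo_irr//; case: lo.
have rank_mono p q : lo p q -> (rank p < rank q)%N.
  move=> pq; apply: proper_card; apply/properP; split.
    by apply/fintype.subsetP => r; rewrite !inE => rp; exact: lo_trans rp pq.
  by exists p; rewrite !inE ?lo_irr.
pose rk q := Ordinal (rank_lt q).
have rk_inj : injective rk.
  move=> p q /(congr1 val) /= pq; apply/eqP; apply/negPn/negP => /lo_total.
  by case/orP => /rank_mono; rewrite pq ltnn.
rewrite /total_score [RHS](reindex_inj rk_inj); apply: eq_bigr => q _.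
by rewrite incidence_sum_pairs rankE.
Qed.

(** Making every edge monotone does not increase the right-hand side.  Lowering
    the sign to -1 at the lower end of an edge only helps; raising it to +1 at the
    higher end is paid by [bump], which is charged to that end. *)
Lemma tournament_lower_bound (alpha beta bump : E -> R) :
  (forall e, -1 <= alpha e) -> (forall e, -1 <= beta e) ->
  (forall e, 0 <= bump e) ->
  (forall e, lo (tgt e) (src e) -> 1 <= alpha e + bump e) ->
  (forall e, lo (src e) (tgt e) -> 1 <= beta e + bump e) ->
  total_score <= \sum_q Num.max (incidence_sum alpha beta q) 0 + \sum_e bump e.
Proof.
move=> a1 b1 c0 ac bc.
rewrite -tournament_score.
(* the vertex to which the maximum inside e is charged: its higher end *)
pose up e q := (if lo (tgt e) (src e) then src e else tgt e) == q.
have -> : \sum_e bump e = \sum_q \sum_(e | up e q) bump e.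
  rewrite (exchange_big_dep xpredT)//=; apply: eq_bigr => e _.
  rewrite (big_pred1 (if lo (tgt e) (src e) then src e else tgt e)) // => q.
  by rewrite /up /= eq_sym.
rewrite -big_split; apply: ler_sum => q _ /=.
have B0 : 0 <= \sum_(e | up e q) bump e by apply: sumr_ge0.
rewrite ge_max; apply/andP; split; last first.
  by rewrite addr_ge0// le_max lexx orbT.
apply: (@le_trans _ _ (incidence_sum alpha beta q + \sum_(e | up e q) bump e)); last first.
  by rewrite lerD2r le_max lexx.
have ne (e : E) : src e != tgt e.
  by case: e => -[i j] /= ij; rewrite -(inj_eq val_inj) /= neq_ltn ij.
have -> : \sum_(e | up e q) bump e =
    \sum_(e | src e == q) (if lo (tgt e) (src e) then bump e else 0) +
    \sum_(e | tgt e == q) (if lo (tgt e) (src e) then 0 else bump e).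
  rewrite big_mkcond [X in _ = X + _]big_mkcond [X in _ = _ + X]big_mkcond /=.
  rewrite -big_split; apply: eq_bigr => e _ /=; rewrite /up.
  by case: (lo _ _); case: (src e == q); case: (tgt e == q); rewrite ?addr0 ?add0r.
rewrite /incidence_sum addrACA -!big_split; apply: lerD; apply: ler_sum => e _ /=.
  by rewrite /local_sign; case: ifP => l; [exact: ac|rewrite addr0].
rewrite /local_sign; have [st|ts] := orP (lo_total (ne e)).
  rewrite st ifF; first exact: bc.
  by apply/negP => ts; have := lo_trans st ts; rewrite lo_irr.
rewrite ts addr0 ifF//.
by apply/negP => st; have := lo_trans st ts; rewrite lo_irr.
Qed.

End Tournament.

Lemma sum_odd_numbers (R : realFieldType) l :
  \sum_(0 <= k < l) (k%:R *+ 2 + 1 : R) = l%:R ^+ 2.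
Proof.
elim: l => [|l IH]; first by rewrite big_geq// expr0n.
by rewrite big_nat_recr//= IH -natr1; ring.
Qed.

Lemma sum_even_numbers (R : realFieldType) l :
  \sum_(0 <= k < l) (k.+1%:R *+ 2 : R) = l%:R * (l%:R + 1).
Proof.
elim: l => [|l IH]; first by rewrite big_geq// mul0r.
by rewrite big_nat_recr//= IH -natr1; ring.
Qed.

Lemma total_score_even (R : realFieldType) l : (1 <= l)%N ->
  @total_score R (2 * l) = l%:R ^+ 2.
Proof.
move=> l1; rewrite /total_score -(big_mkord xpredT (fun k => Num.max (k%:R *+ 2 - _) 0)).
rewrite (@big_cat_nat _ _ _ l) //=; last by rewrite mul2n -addnn leq_addr.
have e : (2 * l).-1%:R = l%:R *+ 2 - 1 :> R.
  by rewrite -subn1 natrB ?muln_gt0// natrM mulrC mulr_natr.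
rewrite big_nat_cond big1 ?add0r; last first.
  move=> k /andP[/andP[_ kl] _]; apply: max_r; rewrite e.
  have : k.+1%:R <= l%:R :> R by rewrite ler_nat.
  by rewrite -natr1; lra.
rewrite -[X in \sum_(X <= _ < _) _]add0n big_addn mul2n -addnn addnK -sum_odd_numbers.
rewrite addnn -mul2n; apply: eq_bigr => k _; rewrite e natrD.
by have k0 : 0 <= k%:R :> R by []; rewrite max_l; lra.
Qed.

Lemma total_score_odd (R : realFieldType) l :
  @total_score R (2 * l + 1) = l%:R * (l%:R + 1).
Proof.
rewrite /total_score -(big_mkord xpredT (fun k => Num.max (k%:R *+ 2 - _) 0)).
rewrite (@big_cat_nat _ _ _ l.+1) //=; last by rewrite addn1 ltnS mul2n -addnn leq_addr.
have e : (2 * l + 1).-1%:R = l%:R *+ 2 :> R.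
  by rewrite addn1 /= natrM mulrC mulr_natr.
rewrite big_nat_cond big1 ?add0r; last first.
  move=> k /andP[/andP[_ kl] _]; apply: max_r; rewrite e.
  have : k%:R <= l%:R :> R by rewrite ler_nat.
  by lra.
rewrite -[X in \sum_(X <= _ < _) _]add0n big_addn -sum_even_numbers.
rewrite (_ : (2 * l + 1 - l.+1)%N = l); last by rewrite addn1 subSS mul2n -addnn addnK.
apply: eq_bigr => k _; rewrite e addnS -addSn natrD.
by have k0 : 0 <= k.+1%:R :> R by []; rewrite max_l; lra.
Qed.

(** * Walking along an edge *)

Section EdgeWalk.
Context {R : realType}.

(** Here [h] is the height along an edge, and [da], [db] are the slopes seen when
    leaving a point forwards and backwards.  A height that rises along one piece can
    only start to fall at a breakpoint or inside a later piece; both are excluded, so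
    the rise propagates from piece to piece; likewise backwards from the end. *)
Lemma edge_walk (h da db : R -> R) (s : seq R) (a : R) :
  (forall p, p \in zip (a :: s) (rcons s 1) ->
    [/\ da p.1 != 0, db p.2 != 0,
        0 < da p.1 -> h p.1 < h p.2 /\ db p.2 <= 0 &
        0 < db p.2 -> h p.2 < h p.1 /\ da p.1 <= 0]) ->
  (forall t, t \in s -> ~ (db t < 0 /\ da t < 0)) ->
  (0 < da a -> h a < h 1 /\ db 1 <= 0) /\
  (0 < db 1 -> h 1 < h a /\ da a <= 0).
Proof.
elim: s a => [|t s IH] a Hp Hb.
  have [|_ _ ? ?] := Hp (a, 1); first by rewrite inE.
  by split.
have [|_ bt0 Pa Pb] := Hp (a, t); first by rewrite inE eqxx.
have [IHa IHb] : (0 < da t -> h t < h 1 /\ db 1 <= 0) /\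
  (0 < db 1 -> h 1 < h t /\ da t <= 0).
  apply: IH => [p pin|u us]; first by apply: Hp; rewrite inE pin orbT.
  by apply: Hb; rewrite inE us orbT.
have at0 : da t != 0.
  case: s Hp {IH IHa IHb Hb} => [|u s] Hp.
    by have [] := Hp (t, 1); rewrite ?inE ?eqxx ?orbT.
  by have [] := Hp (t, u); rewrite ?inE ?eqxx ?orbT.
have nomax := Hb t (mem_head _ _).
split=> H.
- have [ht bt] := Pa H; have {}bt : db t < 0 by rewrite lt_neqAle bt0.
  have {}at0 : 0 < da t.
    by rewrite lt_neqAle eq_sym at0 leNgt; apply/negP => ?; exact: nomax.
  by have [h1 h2] := IHa at0; split => //; exact: lt_trans h1.
- have [ht bt] := IHb H; have {}at0 : da t < 0 by rewrite lt_neqAle at0.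
  have {}bt0 : 0 < db t.
    by rewrite lt_neqAle eq_sym bt0 leNgt; apply/negP => ?; exact: nomax.
  by have [h1 h2] := Pb bt0; split => //; exact: lt_trans ht _.
Qed.

Lemma pieces_lt (s : seq R) (a : R) p : path <%R a (rcons s 1) ->
  p \in zip (a :: s) (rcons s 1) -> a <= p.1 /\ p.1 < p.2 /\ p.2 <= 1.
Proof.
elim: s a => [|t s IH] a /= /andP[a1].
  by rewrite inE => _ /eqP -> /=.
move=> ps; rewrite inE => /predU1P[->|] /=.
  split=> //; split => //.
  have := order_path_min (@lt_trans _ R) ps => /allP /(_ 1).
  by rewrite mem_rcons inE eqxx => /(_ isT) /ltW.
by move=> /(IH _ ps)[tp1 ?]; split => //; exact: le_trans (ltW a1) tp1.
Qed.

Lemma ends_of_pieces (s : seq R) : exists p p', [/\ p \in pieces s, p.1 = 0,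
  p' \in pieces s & p'.2 = 1].
Proof.
rewrite /pieces; case: s => [|t s].
  by exists (0, 1), (0, 1); rewrite inE eqxx.
exists (0, t), (last 0 (t :: s), 1); split => //; first by rewrite inE eqxx.
rewrite [0 :: t :: s]lastI zip_rcons; last by rewrite size_belast.
by rewrite mem_rcons inE eqxx.
Qed.

End EdgeWalk.

Section CompleteGraph.
Context {R : realType}.
Local Notation T := (measurableTypeR R).

(** The integrand of [ntc], viewed as a function on the space of tuples. *)
Definition net_max n (Ts : seq 'rV[R]_n) (x : n.-tuple T) : R :=
  Num.max (\sum_(v <- Ts) chi v (row_of_tuple x)) 0.

Lemma net_max_ge0 n Ts (x : n.-tuple T) : 0 <= net_max Ts x.
Proof. by rewrite /net_max le_max lexx orbT. Qed.

Lemma measurable_chi n (v : 'rV[R]_n) :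
  measurable_fun setT (fun x : n.-tuple T => chi v (row_of_tuple x)).
Proof.
apply: measurable_funN.
apply: (@measurableT_comp _ _ _ _ _ _ (fun y : R => Num.sg y)); last first.
  exact: measurable_dot.
apply: nondecreasing_measurable => // x y xy.
by case: (sgrP x) xy => x0; case: (sgrP y) => y0 xy; lra.
Qed.

Lemma measurable_net_max n (Ts : seq 'rV[R]_n) : measurable_fun setT (net_max Ts).
Proof.
apply: measurable_maxr => //; apply: measurable_sum => v; exact: measurable_chi.
Qed.

Lemma chi_unitv n (v e : 'rV[R]_n) : chi v (unitv e) = chi v e.
Proof.
rewrite /chi /unitv dotZl sgrM.
have [->|e0] := eqVneq e 0; first by rewrite !dot0l sgr0 mulr0.
by rewrite gtr0_sg ?mul1r// invr_gt0 enorm_gt0.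
Qed.

Lemma ntcE n (Ts : seq 'rV[R]_n) :
  ntc Ts = (pi%:E * \int[@sph R n]_x (net_max Ts x)%:E)%E.
Proof.
rewrite /ntc (sphere_averageE (G := net_max Ts))//.
- by move=> x; rewrite /net_max; congr Num.max; apply: eq_bigr => v _; rewrite chi_unitv.
- by move=> x; exact: net_max_ge0.
- exact: measurable_net_max.
Qed.

End CompleteGraph.

(** * The lower bound *)

Section DirectionIntegral.
Context {R : realType} {n : nat}.
Local Notation T := (measurableTypeR R).
Implicit Types F G : n.-tuple T -> R.

(** The average over directions with the factor pi of [ntc] included. *)
Definition directional F : \bar R := (pi%:E * \int[@sph R n]_x (F x)%:E)%E.

Let pi0 : (0 <= pi%:E :> \bar R)%E.
Proof. by rewrite lee_fin ltW// pi_gt0. Qed.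

Lemma directionalD F G : measurable_fun setT F -> measurable_fun setT G ->
  (forall x, 0 <= F x) -> (forall x, 0 <= G x) ->
  directional (fun x => F x + G x) = (directional F + directional G)%E.
Proof.
move=> mF mG F0 G0; rewrite /directional -ge0_muleDr; last 2 first.
- by apply: integral_ge0 => x _; rewrite lee_fin.
- by apply: integral_ge0 => x _; rewrite lee_fin.
congr (_ * _)%E; rewrite -ge0_integralD//=.
- by move=> x _; rewrite lee_fin.
- exact/measurable_EFinP.
- by move=> x _; rewrite lee_fin.
- exact/measurable_EFinP.
Qed.

Lemma directional_sum (I : Type) (s : seq I) (F : I -> n.-tuple T -> R) :
  (forall i, measurable_fun setT (F i)) -> (forall i x, 0 <= F i x) ->
  directional (fun x => \sum_(i <- s) F i x) = (\sum_(i <- s) directional (F i))%E.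
Proof.
move=> mF F0; elim: s => [|i s IH].
  rewrite big_nil /directional; under eq_integral do rewrite big_nil.
  by rewrite integral0 mule0.
rewrite big_cons -IH -directionalD//.
- by congr directional; apply/funext => x; rewrite big_cons.
- exact: measurable_sum.
- by move=> x; apply: sumr_ge0.
Qed.

Lemma directional_indic (W : set (n.-tuple T)) : measurable W ->
  directional (fun x => 2 * \1_W x) = ((pi *+ 2)%:E * sph W)%E.
Proof.
move=> mW; rewrite /directional; under eq_integral do rewrite EFinM.
rewrite ge0_integralZl//; last by apply/measurable_EFinP; exact: measurable_indic.
by rewrite integral_indic// setIT muleA -EFinM mulr_natr.
Qed.

Lemma directional_le F (k : R) : 0 <= k -> measurable_fun setT F ->
  (forall x, 0 <= F x) -> (\forall x \ae @sph R n, k <= F x) ->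
  ((pi * k)%:E <= directional F)%E.
Proof.
move=> k0 mF F0 kF; rewrite EFinM lee_wpmul2l//.
rewrite -[leLHS]mule1 -(@sph_setT R n) -integral_cst//.
apply: ae_ge0_le_integral => //=.
- by move=> x _; rewrite lee_fin.
- exact/measurable_EFinP.
- by move: kF; apply: filterS => x kFx _; rewrite lee_fin.
Qed.

Lemma ae_nonorthogonal (L : seq 'rV[R]_n) : {in L, forall v, v != 0} ->
  \forall x \ae @sph R n, {in L, forall v, dot (row_of_tuple x) v != 0}.
Proof.
elim: L => [_|v L IH vL].
  by apply: aeW => x v; rewrite in_nil.
have IH' : {in L, forall v, v != 0} by move=> w wL; apply: vL; rewrite inE wL orbT.
have v0 : v != 0 by apply: vL; rewrite inE eqxx.
have H1 : \forall x \ae @sph R n, dot (row_of_tuple x) v != 0.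
  exists [set x | dot (row_of_tuple x) v = 0]; split.
  - exact: (measurable_preim (measurable_dot v) (measurable_set1 0)).
  - exact: sph_hyperplane.
  - by move=> x /= /negP/negPn/eqP.
apply: filterS2 H1 (IH IH') => x xv xL w; rewrite inE => /predU1P[->//|]; exact: xL.
Qed.

End DirectionIntegral.

Section LowerBound.
Context {R : realType} {m n : nat} (f : pwC2_map R (complete_graph m) n).
Local Notation T := (measurableTypeR R).
Local Notation E := (edge (complete_graph m)).

Lemma sum_chi_tangents_at (q : 'I_m) (r : 'rV[R]_n) :
  \sum_(v <- tangents_at f q) chi v r =
  incidence_sum (fun e => chi (tangent_after (curve f e) 0) r)
    (fun e => chi (tangent_before (curve f e) 1) r) q.
Proof.
rewrite /tangents_at big_cat !big_map !big_filter /=.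
by congr (_ + _); rewrite big_enum_cond.
Qed.

Lemma le_sum_member (I : eqType) (s : seq I) (F : I -> R) i :
  (forall i, 0 <= F i) -> i \in s -> F i <= \sum_(j <- s) F j.
Proof. by move=> F0 ins; rewrite (big_rem i)//= lerDl sumr_ge0. Qed.

(** NTC is at least the directional integral of Phi, the count of local maxima, in
    which each arc has been replaced by twice the indicator of its turning
    directions; and Phi is at least the total score away from the hyperplanes
    orthogonal to the finitely many end tangents of the pieces. *)
Lemma NTC_lower_bound : ((pi * total_score (m := m))%:E <= NTC f)%E.
Proof.
have plt (e : E) p : p \in pieces (brk f e) -> p.1 < p.2.
  by move=> pe; have [_ []] := pieces_lt (brk_sorted f e) pe.
pose good (e : E) (p : R * R) (W : set (n.-tuple T)) :=
  [/\ ((pi *+ 2)%:E * sph W <= total_curvature (curve f e) p.1 p.2)%E,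
    tangent_after (curve f e) p.1 != 0, tangent_before (curve f e) p.2 != 0 &
    forall x, ~ W x -> let h t := dot (row_of_tuple x) (curve f e t) in
    (0 < dot (row_of_tuple x) (tangent_after (curve f e) p.1) ->
      h p.1 < h p.2 /\ dot (row_of_tuple x) (tangent_before (curve f e) p.2) <= 0) /\
    (0 < dot (row_of_tuple x) (tangent_before (curve f e) p.2) ->
      h p.2 < h p.1 /\ dot (row_of_tuple x) (tangent_after (curve f e) p.1) <= 0)].
have [W HW] : {W : E * (R * R) -> set (n.-tuple T) &
    forall ep, measurable (W ep) /\
     (ep.2 \in pieces (brk f ep.1) -> good ep.1 ep.2 (W ep))}.
  apply: (@boolp.choice _ _ (fun ep W => measurable W /\
     (ep.2 \in pieces (brk f ep.1) -> good ep.1 ep.2 W))) => -[e p] /=.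
  have [pe|pe] := boolP (p \in pieces (brk f e)); last by exists set0.
  have [W [mW W1 W2 W3 W4]] := arc_directions (plt e p pe) (curve_regular pe).
  by exists W; exact: (conj mW (fun _ => And4 W1 W2 W3 W4)).
pose A (q : 'I_m) := net_max (tangents_at f q).
pose B (e : E) t := net_max (tangents_at_brk f e t).
pose K (e : E) p (x : n.-tuple T) : R := 2 * \1_(W (e, p)) x.
pose bump (e : E) x := \sum_(t <- brk f e) B e t x + \sum_(p <- pieces (brk f e)) K e p x.
pose Phi x := \sum_q A q x + \sum_e bump e x.
have K0 e p x : 0 <= K e p x by rewrite mulr_ge0.
have mK e p : measurable_fun setT (K e p).
  by apply: measurable_funM => //; apply: measurable_indic; have [] := HW (e, p).
have B0 e t x : 0 <= B e t x by exact: net_max_ge0.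
have bump0 e x : 0 <= bump e x by rewrite addr_ge0// sumr_ge0.
have mB e t : measurable_fun setT (B e t) by exact: measurable_net_max.
have mbump e : measurable_fun setT (bump e).
  by apply: measurable_funD; exact: measurable_sum.
have A0 q x : 0 <= A q x by exact: net_max_ge0.
have mA q : measurable_fun setT (A q) by exact: measurable_net_max.
have mPhi : measurable_fun setT Phi by apply: measurable_funD; exact: measurable_sum.
have Phi0 x : 0 <= Phi x by rewrite addr_ge0// sumr_ge0.
have score0 : 0 <= total_score (m := m) :> R.
  by apply: sumr_ge0 => k _; rewrite le_max lexx orbT.
apply: (@le_trans _ _ (directional Phi)); last first.
  rewrite /Phi directionalD//; [|exact: measurable_sum|exact: measurable_sum
    |by move=> x; exact: sumr_ge0|by move=> x; exact: sumr_ge0].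
  rewrite !directional_sum// /NTC -addeA; apply: leeD.
    by apply: lee_sum => q _; rewrite ntcE.
  rewrite -big_split /=; apply: lee_sum => e _.
  rewrite /bump directionalD//; [|exact: measurable_sum|exact: measurable_sum
    |by move=> x; exact: sumr_ge0|by move=> x; exact: sumr_ge0].
  rewrite !directional_sum//; apply: leeD.
    by apply: lee_sum => t _; rewrite ntcE.
  rewrite big_seq [leRHS]big_seq; apply: lee_sum => p pe.
  have [mW /(_ pe)[W1 _ _ _]] := HW (e, p).
  by rewrite directional_indic.
apply: directional_le => //.
pose L := flatten [seq flatten [seq [:: tangent_after (curve f e) p.1;
  tangent_before (curve f e) p.2] | p <- pieces (brk f e)] | e <- enum E].
have inL (e : E) p : p \in pieces (brk f e) -> tangent_after (curve f e) p.1 \in L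
    /\ tangent_before (curve f e) p.2 \in L.
  move=> pe; have eE : e \in enum E by rewrite mem_enum.
  by split; apply/flattenP; (eexists; first by apply: map_f eE);
    apply/flattenP; (eexists; first by apply: map_f pe); rewrite !inE eqxx ?orbT.
have L0 : {in L, forall v, v != 0}.
  move=> u /flattenP[_ /mapP[e _ ->]] /flattenP[_ /mapP[p pe ->]].
  have [_ /(_ pe)[_ t1 t2 _]] := HW (e, p).
  by rewrite !inE => /orP[/eqP ->|/eqP ->]; [exact: t1|exact: t2].
apply: filterS (ae_nonorthogonal L0) => x xL.
set r := row_of_tuple x.
pose ht (q : 'I_m) := dot r (pos f q).
(* ties have to be broken: f need not separate the vertices *)
pose lo (p q : 'I_m) := (ht p < ht q) || (ht p == ht q) && (p < q)%N.
(* a piece turning at x, or a breakpoint that is a maximum, contributes 2 *)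
have walk (e : E) : bump e x < 2 ->
   let h t := dot r (curve f e t) in
   let da t := dot r (tangent_after (curve f e) t) in
   let db t := dot r (tangent_before (curve f e) t) in
   (0 < da 0 -> h 0 < h 1 /\ db 1 <= 0) /\ (0 < db 1 -> h 1 < h 0 /\ da 0 <= 0).
  move=> b2 h da db; apply: (@edge_walk _ h da db (brk f e)).
    move=> p pe; have [/xL a0 /xL b0] := inL e p pe.
    have [_ /(_ pe)[_ _ _ /(_ x)]] := HW (e, p).
    have nW : ~ W (e, p) x.
      move=> Wx; move: b2; apply/negP; rewrite -leNgt.
      have := le_sum_member (fun p => K0 e p x) pe.
      rewrite {1}/K indicE mem_set// mulr1 => /le_trans; apply.
      by rewrite lerDr sumr_ge0.
    by move=> /(_ nW) [h1 h2]; exact: (And4 a0 b0 h1 h2).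
  move=> t te [bt at_]; move: b2; apply/negP; rewrite -leNgt.
  have := le_sum_member (fun t => B0 e t x) te.
  rewrite {1}/B /net_max /tangents_at_brk !big_cons big_nil /chi -/r.
  rewrite (ltr0_sg bt) (ltr0_sg at_) => h2.
  have {h2} : 2 <= \sum_(j <- brk f e) B e j x.
    by apply: le_trans h2; rewrite opprK addr0 le_max; apply/orP; left.
  by move=> /le_trans; apply; rewrite lerDl sumr_ge0.
have chi_ge (v : 'rV[R]_n) : -1 <= chi v r.
  by rewrite /chi lerN2; case: sgrP.
have chi_pos (v : 'rV[R]_n) b : dot r v != 0 -> 0 <= b ->
    (0 < dot r v -> 2 <= b) -> 1 <= chi v r + b.
  rewrite /chi => v0 b0 hb; case: (ltgtP (dot r v) 0) v0 => // vv _.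
    by rewrite ltr0_sg//; lra.
  by rewrite gtr0_sg//; have := hb vv; lra.
have ends e := ends_of_pieces (brk f e).
apply: le_trans (tournament_lower_bound (lo := lo)
  (alpha := fun e => chi (tangent_after (curve f e) 0) r)
  (beta := fun e => chi (tangent_before (curve f e) 1) r)
  (bump := fun e => bump e x) _ _ _ _ _ _ _ _) _ => //.
- by move=> p; rewrite /lo ltxx ltnn andbF.
- move=> q p s; rewrite /lo => /orP[pq|/andP[/eqP pq pq']] /orP[qs|/andP[/eqP qs qs']].
  + by rewrite (lt_trans pq qs).
  + by rewrite -qs pq.
  + by rewrite pq qs.
  + by rewrite pq qs eqxx (ltn_trans pq' qs') orbT.
- move=> p q pq; rewrite /lo; case: (ltgtP (ht p) (ht q)) => //= _.
  by move: pq; rewrite -(inj_eq val_inj) neq_ltn.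
- move=> e l; apply: chi_pos => //.
    have [p [_ [pe p0 _ _]]] := ends e; have [pL _] := inL e p pe.
    by rewrite p0 in pL; exact: xL.
  move=> d0; rewrite leNgt; apply/negP => /walk [/(_ d0) [hh _] _].
  move: l; rewrite /lo /ht -curve_src -curve_tgt.
  by case/orP => [/(lt_trans hh)|/andP[/eqP hh' _]]; [rewrite ltxx|rewrite hh' ltxx in hh].
- move=> e l; apply: chi_pos => //.
    have [_ [p [_ _ pe p1]]] := ends e; have [_ pL] := inL e p pe.
    by rewrite p1 in pL; exact: xL.
  move=> d0; rewrite leNgt; apply/negP => /walk [_ /(_ d0) [hh _]].
  move: l; rewrite /lo /ht -curve_src -curve_tgt.
  by case/orP => [/(lt_trans hh)|/andP[/eqP hh' _]]; [rewrite ltxx|rewrite hh' ltxx in hh].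
- rewrite /Phi lerD2r; apply: ler_sum => q _.
  by rewrite /A /net_max sum_chi_tangents_at.
Qed.

End LowerBound.

(** * Monotone maps to the line *)

Section MonotoneMaps.
Context {R : realType}.
Local Notation T := (measurableTypeR R).

(** By the mean value theorem: a negative derivative at t would make the height
    fall on a nearby subinterval on one side of t. *)
Lemma monotone_velocity n (a b : R) (c gamma : R -> 'rV[R]_n) (x : 'rV[R]_n) t :
  a < b -> C2 gamma -> {in `[a, b], c =1 gamma} ->
  {in `[a, b] &, {homo (fun s => dot x (c s)) : s u / s < u}} ->
  t \in `[a, b] -> 0 <= dot x (gamma^`()%classic t).
Proof.
move=> ab gC2 cg mono tab; rewrite leNgt; apply/negP => neg.
have cF : {for t, continuous (fun u => dot x (gamma^`()%classic u))}.
  by apply: continuous_dot; [exact: cvg_cst|exact: velocity_continuous].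
have /nbhs_ballP[d /= d0 H] : \forall u \near t, dot x (gamma^`()%classic u) < 0.
  by apply: (cvgr_lt _ cF).
have /andP[at_ tb] : a <= t <= b by rewrite in_itv in tab.
have [s1 [s2 [s12 s1ab s2ab near_t]]] : exists s1 s2, [/\ s1 < s2,
    s1 \in `[a, b], s2 \in `[a, b] & forall u, s1 < u < s2 -> `|t - u| < d].
  have [tb'|bt] := ltP t b.
    exists t, (Num.min b (t + d)); rewrite lt_min tb' ltrDl d0 tab in_itv /=.
    split => // [|u /andP[tu]].
      by rewrite ge_min lexx le_min (le_trans at_ tb)/= (le_trans at_)// lerDl ltW.
    by rewrite lt_min => /andP[_ ud]; rewrite ltr_norml; apply/andP; split; lra.
  exists (Num.max a (t - d)), t; rewrite gt_max (lt_le_trans ab bt) tab in_itv /=.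
  split => //; first by lra.
    by rewrite le_max lexx ge_max (ltW ab)/= (le_trans _ tb)// lerBlDr lerDl ltW.
  move=> u /andP[]; rewrite gt_max => /andP[_ du] ut.
  by rewrite ltr_norml; apply/andP; split; lra.
have [u /itvP us e] := height_MVT x gC2 s12.
have hu : dot x (gamma^`()%classic u) < 0 by apply: H; apply: near_t; rewrite !us.
have := mono _ _ s1ab s2ab s12; rewrite !cg// => hs.
have : dot x (gamma^`()%classic u) * (s2 - s1) < 0 by rewrite nmulr_rlt0// subr_gt0.
by rewrite -e subr_lt0 ltNge ltW.
Qed.

Lemma dot1 (u v : 'rV[R]_1) : dot u v = u ord0 ord0 * v ord0 ord0.
Proof. by rewrite /dot big_ord1. Qed.

Lemma row1_eq0 (u : 'rV[R]_1) : (u == 0) = (u ord0 ord0 == 0).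
Proof. by rewrite -dot_eq0 dot1 mulf_eq0 orbb. Qed.

Lemma monotone_tangents (a b : R) (c : R -> 'rV[R]_1) (x : 'rV[R]_1) :
  a < b -> regular_C2_arc a b c -> x != 0 ->
  {in `[a, b] &, {homo (fun s => dot x (c s)) : s u / s < u}} ->
  0 < dot x (tangent_after c a) /\ dot x (tangent_before c b) < 0.
Proof.
move=> ab [gamma [gC2 cg g0]] x0 mono.
have aab : a \in `[a, b] by rewrite in_itv /= lexx ltW.
have bab : b \in `[a, b] by rewrite in_itv /= lexx ltW.
have dg t : derivable gamma t 1 by case: gC2.
rewrite (tangent_afterE ab cg)// (tangent_beforeE ab cg)// dotNr oppr_lt0.
have pos t : t \in `[a, b] -> 0 < dot x (gamma^`()%classic t).
  move=> tab; rewrite lt_neqAle (monotone_velocity ab gC2 cg mono tab) andbT eq_sym.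
  by rewrite dot1 mulf_eq0 -!row1_eq0 negb_or x0 g0.
by split; (rewrite dot_unitv_gt0; [exact: pos|exact: g0]).
Qed.

(** On the line <v, v'> v = |v|^2 v', so the two terms of [dunit] cancel. *)
Lemma total_curvature_line (a b : R) (c : R -> 'rV[R]_1) :
  a < b -> regular_C2_arc a b c -> total_curvature c a b = 0%E.
Proof.
move=> ab [gamma [gC2 cg g0]].
rewrite (total_curvatureE ab gC2 cg g0); congr EFin.
rewrite (@eq_Rintegral _ _ _ _ _ (fun _ => 0)); first by rewrite /Rintegral integral0.
move=> t /set_mem tab.
have v0 := g0 _ tab.
suff -> : dunit gamma^`()%classic t = 0 by rewrite /enorm dot0l sqrtr0.
apply/eqP; rewrite row1_eq0 /dunit !mxE dot1.
set v := gamma^`()%classic t in v0 *.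
have e0 : enorm v != 0 by rewrite enorm_eq0.
have e2 : enorm v ^+ 2 = v ord0 ord0 * v ord0 ord0 by rewrite sqr_enorm dot1.
move: e0 e2; move: (enorm v) (v ord0 ord0) => y z y0 e2.
apply/eqP; set w := (X in _ * X - _).
rewrite (_ : z * w / y ^+ 3 * z = (z * z) * w / y ^+ 3); last by ring.
by rewrite -e2; field.
Qed.

Lemma brk_pieces (s : seq R) (a t : R) : t \in s ->
  (exists2 p, p \in zip (a :: s) (rcons s 1) & p.2 = t) /\
  (exists2 p, p \in zip (a :: s) (rcons s 1) & p.1 = t).
Proof.
elim: s a => // u s IH a; rewrite inE => /predU1P[->|/(IH u)[[p ps pt] [q qs qt]]].
  split; first by exists (a, u); rewrite // mem_head.
  by case: s {IH} => [|w s]; [exists (u, 1)|exists (u, w)]; rewrite ?inE ?eqxx ?orbT.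
by split; [exists p|exists q]; rewrite //= inE ?ps ?qs orbT.
Qed.

Variables (m : nat) (g : pwC2_map R (complete_graph m) 1).
Local Notation E := (edge (complete_graph m)).

Let piece_lt (e : E) p : p \in pieces (brk g e) -> [/\ 0 <= p.1, p.1 < p.2 & p.2 <= 1].
Proof. by move=> pe; have [? [? ?]] := pieces_lt (brk_sorted g e) pe. Qed.

Let increasing_along (x : 'rV[R]_1) (e : E) :=
  {in `[0, 1] &, {homo (fun s => dot x (curve g e s)) : s u / s < u}}.

Lemma monotone_cases (x : 'rV[R]_1) (e : E) : x != 0 -> monotone_on_edge g e ->
  increasing_along x e \/ increasing_along (- x) e.
Proof.
rewrite row1_eq0 => x0; case: (ltgtP (x ord0 ord0) 0) x0 => // xs _ [] mono.
- right=> s u s01 u01 su; rewrite !dotNl !dot1 ltrN2 ltr_nM2l//; exact: mono.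
- left=> s u s01 u01 su; rewrite !dot1 ltr_nM2l//; exact: mono.
- left=> s u s01 u01 su; rewrite !dot1 ltr_pM2l//; exact: mono.
- right=> s u s01 u01 su; rewrite !dotNl !dot1 ltrN2 ltr_pM2l//; exact: mono.
Qed.

Lemma increasing_pieces x (e : E) p : x != 0 -> increasing_along x e ->
  p \in pieces (brk g e) ->
  0 < dot x (tangent_after (curve g e) p.1) /\ dot x (tangent_before (curve g e) p.2) < 0.
Proof.
move=> x0 inc pe; have [p1 p12 p2] := piece_lt pe.
apply: monotone_tangents => //; first exact: curve_regular pe.
move=> s u; rewrite !in_itv /= => /andP[s1 s2] /andP[u1 u2] su.
by apply: inc => //; rewrite in_itv /= ?(le_trans p1)//= ?(le_trans _ p2).
Qed.

Lemma increasing_ends x (e : E) : x != 0 -> increasing_along x e ->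
  0 < dot x (tangent_after (curve g e) 0) /\ dot x (tangent_before (curve g e) 1) < 0.
Proof.
move=> x0 inc; have [p [q [pe p0 qe q1]]] := ends_of_pieces (brk g e).
have [h1 _] := increasing_pieces x0 inc pe; have [_ h2] := increasing_pieces x0 inc qe.
by rewrite -[X in tangent_after _ X]p0 -[X in tangent_before _ X]q1.
Qed.

(** The two tangents at a breakpoint of a monotone edge are opposite. *)
Lemma net_max_monotone_brk (e : E) t (x : 1.-tuple T) : monotone_on_edge g e ->
  t \in brk g e -> net_max (tangents_at_brk g e t) x = 0.
Proof.
move=> mono te; rewrite /net_max /tangents_at_brk !big_cons big_nil addr0.
set r := row_of_tuple x; suff -> : chi (tangent_before (curve g e) t) r +
  chi (tangent_after (curve g e) t) r = 0 by rewrite maxxx.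
have [[p pe p2] [q qe q1]] := brk_pieces 0 te.
have [->|r0] := eqVneq r 0; first by rewrite /chi !dot0l sgr0 oppr0 addr0.
rewrite /chi; case: (monotone_cases r0 mono) => inc.
  have [_ h1] := increasing_pieces r0 inc pe; have [h2 _] := increasing_pieces r0 inc qe.
  by rewrite p2 in h1; rewrite q1 in h2; rewrite ltr0_sg// gtr0_sg// opprK subrr.
have r0' : - r != 0 by rewrite oppr_eq0.
have [_ h1] := increasing_pieces r0' inc pe; have [h2 _] := increasing_pieces r0' inc qe.
rewrite p2 dotNl oppr_lt0 in h1; rewrite q1 dotNl oppr_gt0 in h2.
by rewrite gtr0_sg// ltr0_sg// opprK addNr.
Qed.

Hypotheses (gpos : vertices_in_general_position g)
  (gmono : forall e, monotone_on_edge g e).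

Lemma sum_net_max_monotone (x : 1.-tuple T) : row_of_tuple x != 0 ->
  \sum_(q : 'I_m) net_max (tangents_at g q) x = total_score (m := m).
Proof.
set r := row_of_tuple x => r0.
pose lo (p q : 'I_m) := dot r (pos g p) < dot r (pos g q).
rewrite -(tournament_score (lo := lo)); first last.
- move=> p q pq; rewrite /lo; case: ltgtP => //= e.
  case/eqP: pq; apply: gpos; apply/rowP => i; rewrite (ord1 i).
  by move: e; rewrite !dot1; apply: mulfI; rewrite -row1_eq0.
- by move=> q p s; rewrite /lo; exact: lt_trans.
- by move=> p; rewrite /lo ltxx.
apply: eq_bigr => q _; rewrite /net_max sum_chi_tangents_at -/r; congr (Num.max _ 0).
have main (e : E) :
    chi (tangent_after (curve g e) 0) r = local_sign lo (src e) (tgt e) /\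
    chi (tangent_before (curve g e) 1) r = local_sign lo (tgt e) (src e).
  rewrite /local_sign /lo /chi -curve_src -curve_tgt.
  have i0 : 0 \in `[0, 1 : R] by rewrite in_itv /= lexx ler01.
  have i1 : 1 \in `[0, 1 : R] by rewrite in_itv /= lexx ler01.
  case: (monotone_cases r0 (gmono e)) => inc.
    have [h1 h2] := increasing_ends r0 inc; have h := inc _ _ i0 i1 ltr01.
    by rewrite gtr0_sg// ltr0_sg// opprK h ltNge (ltW h).
  have r0' : - r != 0 by rewrite oppr_eq0.
  have [h1 h2] := increasing_ends r0' inc; have h := inc _ _ i0 i1 ltr01.
  rewrite dotNl oppr_gt0 in h1; rewrite dotNl oppr_lt0 in h2.
  rewrite !dotNl ltrN2 in h.
  by rewrite ltr0_sg// gtr0_sg// opprK h ltNge (ltW h).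
by rewrite /incidence_sum; congr (_ + _); apply: eq_bigr => e _; have [] := main e.
Qed.

(** Every x other than 0 sees monotone heights, so almost everywhere the vertices
    contribute exactly the total score; arcs and breakpoints contribute nothing. *)
Lemma NTC_monotone : NTC g = (pi * total_score (m := m))%:E.
Proof.
rewrite /NTC [X in (_ + X)%E]big1 ?adde0; last first.
  move=> e _; rewrite big_seq big1// => p pe.
  apply: total_curvature_line; first by have [] := piece_lt pe.
  exact: curve_regular pe.
rewrite [X in (_ + X)%E]big1 ?adde0; last first.
  move=> e _; rewrite big_seq big1// => t te; rewrite ntcE.
  under eq_integral do rewrite net_max_monotone_brk//.
  by rewrite integral0 mule0.
rewrite (eq_bigr (fun q => directional (net_max (tangents_at g q)))); last first.
  by move=> q _; rewrite ntcE.
rewrite -directional_sum; [|by move=> q; exact: measurable_net_max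
  |by move=> q x; exact: net_max_ge0].
rewrite /directional EFinM; congr (_ * _)%E.
have score0 : 0 <= total_score (m := m) :> R.
  by apply: sumr_ge0 => k _; rewrite le_max lexx orbT.
rewrite (ge0_ae_eq_integral (g := cst (total_score (m := m))%:E))//=.
- by rewrite integral_cst//= sph_setT mule1.
- by apply/measurable_EFinP; apply: measurable_sum => q; exact: measurable_net_max.
- by move=> x _; rewrite lee_fin; apply: sumr_ge0 => q _; exact: net_max_ge0.
have one0 : const_mx 1 != 0 :> 'rV[R]_1 by rewrite row1_eq0 mxE oner_eq0.
have L0 : {in [:: const_mx 1 : 'rV[R]_1], forall v, v != 0}.
  by move=> v; rewrite inE => /eqP ->.
have := ae_nonorthogonal L0; apply: filterS => x xL _ /=; congr EFin.
apply: sum_net_max_monotone.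
by have := xL _ (mem_head _ _); apply: contra_neq => ->; rewrite dot0l.
Qed.

End MonotoneMaps.

(** * The straight map and the infimum *)

Section LineMap.
Context {R : realType}.

(** The difference quotient is constant. *)
Lemma is_derive_affine n (A D : 'rV[R]_n) (t : R) :
  derivable (fun s : R => A + s *: D) t 1 /\
  (fun s : R => A + s *: D)^`()%classic t = D.
Proof.
have h : h^-1 *: ((A + (h *: (1 : R) + t) *: D) - (A + t *: D)) @[h --> (0 : R)^'] --> D.
  apply: cvg_near_cst; near=> h.
  have h0 : h != 0 by near: h; exact: nbhs_dnbhs_neq.
  rewrite opprD addrACA subrr add0r -scalerBl /GRing.scale /= mulr1 addrK.
  by rewrite -/(GRing.scale _ _) scalerA mulVf// scale1r.
split; first by apply/cvg_ex; exists D.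
rewrite derive1E; exact: (cvg_lim (@norm_hausdorff _ _) h).
Unshelve. all: by end_near. Qed.

Lemma affine_C2 n (A D : 'rV[R]_n) : C2 (fun s : R => A + s *: D).
Proof.
have d1 : (fun s : R => A + s *: D)^`()%classic = cst D.
  by apply/funext => t; have [] := is_derive_affine A D t.
split=> [t|t|].
- by have [] := is_derive_affine A D t.
- by rewrite d1; exact: derivable_cst.
- rewrite derive1nS derive1n1 d1 (_ : _^`()%classic = cst 0); last first.
    by apply/funext => t; rewrite derive1_cst.
  by move=> t; exact: cvg_cst.
Qed.

Variable m : nat.
Local Notation G := (complete_graph m).

Let pos0 (i : vert G) : 'rV[R]_1 := const_mx (i : 'I_m)%:R.
Let curve0 (e : edge G) (t : R) : 'rV[R]_1 :=
  pos0 (src e) + t *: (pos0 (tgt e) - pos0 (src e)).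

Let curve0_src e : curve0 e 0 = pos0 (src e).
Proof. by rewrite /curve0 scale0r addr0. Qed.

Let curve0_tgt e : curve0 e 1 = pos0 (tgt e).
Proof. by rewrite /curve0 scale1r addrC subrK. Qed.

Let brk0_sorted (e : edge G) : path <%R 0 (rcons [::] (1 : R)).
Proof. by rewrite /= ltr01. Qed.

Let step_gt0 (e : edge G) : 0 < (pos0 (tgt e) - pos0 (src e)) ord0 ord0.
Proof. by rewrite !mxE subr_gt0 ltr_nat; exact: (valP e). Qed.

Let curve0_regular (e : edge G) p : p \in pieces [::] ->
  regular_C2_arc p.1 p.2 (curve0 e).
Proof.
rewrite /pieces /= inE => /eqP -> /=; exists (curve0 e); split => // [|t _].
  exact: affine_C2.
have [_ ->] := is_derive_affine (pos0 (src e)) (pos0 (tgt e) - pos0 (src e)) t.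
by rewrite row1_eq0 gt_eqF.
Qed.

Definition straight_map : pwC2_map R G 1 :=
  PwC2Map curve0_src curve0_tgt brk0_sorted curve0_regular.

Lemma straight_map_general_position : vertices_in_general_position straight_map.
Proof.
move=> i j /matrixP /(_ ord0 ord0); rewrite !mxE => /eqP.
by rewrite eqr_nat => /eqP /val_inj.
Qed.

Lemma straight_map_monotone e : monotone_on_edge straight_map e.
Proof.
left=> s t _ _ st; rewrite /= /curve0 [ltLHS]mxE [ltRHS]mxE ltrD2l.
by rewrite [ltLHS]mxE [ltRHS]mxE ltr_pM2r.
Qed.

End LineMap.

(** The straight map on the line attains the bound, which holds in all
    dimensions. *)
Lemma NTC_graph_complete (R : realType) m :
  NTC_graph R (complete_graph m) = (pi * total_score (m := m))%:E.
Proof.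
apply/eqP; rewrite eq_le; apply/andP; split.
  apply: ereal_inf_lbound; exists 0%N, (straight_map m).
  rewrite NTC_monotone//; first exact: straight_map_general_position.
  exact: straight_map_monotone.
apply: le_ereal_inf_tmp => _ [n [f ->]]; exact: NTC_lower_bound.
Qed.

Theorem proposition8 (R : realType) (l : nat) (hl : (1 <= l)%N) :
  (forall g : pwC2_map R (complete_graph (2 * l)) 1,
     ((pi * l%:R ^+ 2)%:E <= NTC g)%E) /\
  (forall g : pwC2_map R (complete_graph (2 * l + 1)) 1,
     ((pi * l%:R * (l%:R + 1))%:E <= NTC g)%E) /\
  (forall g : pwC2_map R (complete_graph (2 * l)) 1,
     vertices_in_general_position g -> (forall e, monotone_on_edge g e) ->
     NTC g = (pi * l%:R ^+ 2)%:E) /\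
  (forall g : pwC2_map R (complete_graph (2 * l + 1)) 1,
     vertices_in_general_position g -> (forall e, monotone_on_edge g e) ->
     NTC g = (pi * l%:R * (l%:R + 1))%:E) /\
  NTC_graph R (complete_graph (2 * l)) = (pi * l%:R ^+ 2)%:E /\
  NTC_graph R (complete_graph (2 * l + 1)) = (pi * l%:R * (l%:R + 1))%:E.
Proof.
rewrite -mulrA -(total_score_even R hl) -(total_score_odd R l).
split; first by move=> g; exact: NTC_lower_bound.
split; first by move=> g; exact: NTC_lower_bound.
split; first by move=> g; exact: NTC_monotone.
split; first by move=> g; exact: NTC_monotone.
by split; exact: NTC_graph_complete.
Qed.
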